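(* Let $A=\bigoplus_{i\ge0}A_i$ be a commutative Noetherian $\mathbb{N}$-graded ring with identity, and let $n\ge3$ in the linear case and $n=2m\ge6$ in the symplectic case. Let $\alpha\in{\rm S}(n,A)$ with $\alpha^+(0)={\rm I}_n$. If $\alpha_{\mathfrak p}\in[{\rm S}(n,A_{\mathfrak p}),{\rm S}(n,A_{\mathfrak p})]$ for all $\mathfrak p\in{\rm Spec}(A_0)$, then $\alpha\in[{\rm S}(n,A),{\rm S}(n,A)]$.
   Context: $A_iA_j\subseteq A_{i+j}$. For a matrix $\alpha$ over $A$ write $\alpha=\sum_i\alpha_i$ with $\alpha_i$ having entries in $A_i$; for $a\in A_0$, $\alpha^+(a)=\sum_i a^i\alpha_i$, so $\alpha^+(0)=\alpha_0$. For $\mathfrak p\in{\rm Spec}(A_0)$, $A_{\mathfrak p}=(A_0\setminus\mathfrak p)^{-1}A$ and $\alpha_{\mathfrak p}$ is the image of $\alpha$. ${\rm S}(n,A)$ denotes ${\rm SL}_n(A)$ in the linear case and ${\rm Sp}_{2m}(A)=\{\alpha\in{\rm GL}_{2m}(A):\alpha^t\psi_m\alpha=\psi_m\}$ in the symplectic case, where $\psi_m$ is the block-diagonal matrix with $m$ blocks $\begin{pmatrix}0&1\\-1&0\end{pmatrix}$. $[G,G]$ denotes the commutator subgroup. *)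

(* Defs.v *)
From HB Require Import structures.
From mathcomp Require Import all_boot all_order all_algebra.
Set Implicit Arguments. Unset Strict Implicit. Unset Printing Implicit Defensive.
Import GRing.Theory.
Local Open Scope ring_scope.

Definition is_ideal (A : comPzRingType) (I : A -> Prop) : Prop :=
  I 0 /\ (forall x y, I x -> I y -> I (x + y)) /\ (forall r x, I x -> I (r * x)).

Definition noetherian (A : comPzRingType) : Prop :=
  forall I : nat -> A -> Prop,
    (forall k, is_ideal (I k)) ->
    (forall k x, I k x -> I k.+1 x) ->
    exists N, forall k x, (N <= k)%N -> I k x -> I N x.

Definition graded (A : comPzRingType) (Ai : nat -> A -> Prop) : Prop :=
  (forall i, Ai i 0) /\
  (forall i x y, Ai i x -> Ai i y -> Ai i (x - y)) /\
  (forall i j x y, Ai i x -> Ai j y -> Ai (i + j)%N (x * y)) /\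
  (forall a : A, exists N (f : nat -> A),
      (forall i, Ai i (f i)) /\ a = \sum_(i < N) f i) /\
  (forall N (f : nat -> A), (forall i, Ai i (f i)) ->
      \sum_(i < N) f i = 0 -> forall i, (i < N)%N -> f i = 0).

Definition prime_of_A0 (A : comPzRingType) (Ai : nat -> A -> Prop)
    (p : A -> Prop) : Prop :=
  (forall x, p x -> Ai 0%N x) /\
  p 0 /\ (forall x y, p x -> p y -> p (x + y)) /\
  (forall r x, Ai 0%N r -> p x -> p (r * x)) /\
  ~ p 1 /\
  (forall a b, Ai 0%N a -> Ai 0%N b -> p (a * b) -> p a \/ p b).

Definition is_localization (A B : comPzRingType) (S : A -> Prop)
    (phi : {rmorphism A -> B}) : Prop :=
  (forall s, S s -> exists t, phi s * t = 1) /\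
  (forall b, exists a s, S s /\ b * phi s = phi a) /\
  (forall a, phi a = 0 -> exists s, S s /\ s * a = 0).

Inductive Case := Linear | Symplectic.

(* psi_m : block diagonal with blocks [[0,1],[-1,0]] (0-indexed entries). *)
Definition psi (R : comPzRingType) (n : nat) : 'M[R]_n :=
  \matrix_(i < n, j < n)
    (if ~~ odd i && (val j == (val i).+1) then 1
     else if odd i && (val i == (val j).+1) then -1 else 0).

Definition is_invertible (R : comPzRingType) (n : nat) (a : 'M[R]_n) : Prop :=
  exists b : 'M[R]_n, a *m b = 1%:M /\ b *m a = 1%:M.

Definition Sgrp (c : Case) (R : comPzRingType) (n : nat) (a : 'M[R]_n) : Prop :=
  match c with
  | Linear => \det a = 1
  | Symplectic => is_invertible a /\ a^T *m psi R n *m a = psi R n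
  end.

Definition is_commutator (R : comPzRingType) (n : nat)
    (G : 'M[R]_n -> Prop) (x : 'M[R]_n) : Prop :=
  exists b c b' c', G b /\ G c /\ b *m b' = 1%:M /\ b' *m b = 1%:M /\
     c *m c' = 1%:M /\ c' *m c = 1%:M /\ x = b *m c *m b' *m c'.

Inductive comm_sub (R : comPzRingType) (n : nat) (G : 'M[R]_n -> Prop)
    : 'M[R]_n -> Prop :=
  | comm_sub1 : comm_sub G 1%:M
  | comm_subM : forall y x, comm_sub G y -> is_commutator G x ->
                 comm_sub G (y *m x).

Definition dim_ok (c : Case) (n : nat) : Prop :=
  match c with
  | Linear => (3 <= n)%N
  | Symplectic => ~~ odd n /\ (6 <= n)%N
  end.

(* Main.v *)
(* Let [E] be the elementary subgroup of [S(n, -)]: it is normal (Suslin,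
   Kopeiko), contained in the commutator subgroup, and equal to [S(n, -)] over
   local rings. Over [B = A_p] the homotopy [a |-> sum_i a_i T^i] joins any
   matrix to its degree-zero part, which is elementary because [(A_0)_p] is
   local; with Quillen's local-global principle and the normality of [E] this
   shows [[S(n, B), S(n, B)] = E(n, B)]. So the hypothesis says that [alpha] is
   elementary over every [A_p]. Quillen's principle over [Spec A_0], applied to
   [alpha^+(T)] and specialized at [T = 1], gives that [alpha] lies in
   [E(n, A)], hence in the commutator subgroup. *)

Require Import Defs.
From HB Require Import structures.
From mathcomp Require Import all_boot all_order all_algebra.
From mathcomp Require Import boolp classical_sets.
From mathcomp Require Import ring zify.
Set Implicit Arguments. Unset Strict Implicit. Unset Printing Implicit Defensive.
Import GRing.Theory.
Local Open Scope ring_scope.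

(** * Localization at a multiplicative set *)

(** Commutators offer no one-parameter generators, so denominators cannot be cleared among them by a
    substitution [X |-> s X]. Generators of [elem] depend additively on a parameter: when it is
    divisible by [X], the substitution produces factors [s] that pay for denominators. Hence
    matrices are always normalized to be trivial at [X = 0]. Over [B = A_p] the path [theta gamma]
    need not become elementary over [B_q[T]]. Its commutator with a constant matrix [beta] does:
    [beta] is elementary over the local ring [B_q], and normality absorbs the path whatever it is.
    The symplectic generators are transvections along [e_i] and [e_i + e_j]. Conjugation only
    changes the direction of a transvection, so normality becomes the statement that all
    transvections are elementary, and no division by 2 occurs. Localizations are built as nonzero
    rings, hence [mcar0]; the zero ring is set aside at the very end. *)

Record multset (R : comNzRingType) := Multset {
  mcar :> R -> Prop;
  mcar1 : mcar 1;
  mcarM : forall s t, mcar s -> mcar t -> mcar (s * t);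
  mcar0 : ~ mcar 0 }.

Section Localization.
Local Open Scope quotient_scope.
Variables (R : comNzRingType) (S : multset R).

Definition denoms := {s : R | `[< S s >]}.
HB.instance Definition _ := Choice.on denoms.
Definition fracs := (R * denoms)%type.
HB.instance Definition _ := Choice.on fracs.

Definition den (x : fracs) : R := val x.2.
Lemma denP x : S (den x). Proof. exact/asboolP/(valP x.2). Qed.

Definition mkfrac a s (Ss : S s) : fracs := (a, exist _ s (asboolT Ss)).

Definition eqfrac (x y : fracs) : bool :=
  `[< exists2 u, S u & u * (x.1 * den y) = u * (y.1 * den x) >].

Lemma eqfrac_refl : reflexive eqfrac.
Proof. by move=> x; apply/asboolP; exists 1; first exact: mcar1. Qed.

Lemma eqfrac_sym : symmetric eqfrac.
Proof.
by move=> x y; apply/asboolP/asboolP => -[u Su e]; exists u.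
Qed.

Lemma eqfrac_trans : transitive eqfrac.
Proof.
move=> y x z /asboolP[u Su eu] /asboolP[v Sv ev]; apply/asboolP.
exists (u * v * den y); first by do !apply: mcarM => //; exact: denP.
have -> : u * v * den y * (x.1 * den z) = v * den z * (u * (x.1 * den y)) by ring.
have -> : u * v * den y * (z.1 * den x) = u * den x * (v * (z.1 * den y)) by ring.
by rewrite eu -ev; ring.
Qed.

Canonical eqfrac_equiv :=
  EquivRel eqfrac eqfrac_refl eqfrac_sym eqfrac_trans.

Definition loc := {eq_quot eqfrac}.
HB.instance Definition _ : EqQuotient _ eqfrac loc := EqQuotient.on loc.
HB.instance Definition _ := Choice.on loc.

Definition frac a s (Ss : S s) : loc := \pi_loc (mkfrac a Ss).

Lemma eq_fracP a s (Ss : S s) b t (St : S t) :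
  frac a Ss = frac b St <-> exists2 u, S u & u * (a * t) = u * (b * s).
Proof.
split; first by move=> /eqmodP /asboolP.
by move=> e; apply/eqmodP/asboolP.
Qed.

Lemma fracW (P : loc -> Prop) :
  (forall a s (Ss : S s), P (frac a Ss)) -> forall x, P x.
Proof.
move=> h; elim/quotW => -[a [s Ps]].
by have := h a s (asboolW Ps); rewrite /frac /mkfrac (bool_irrelevance (asboolT _) Ps).
Qed.

Lemma frac_congr a b s t (Ss : S s) (St : S t) :
  a * t = b * s -> frac a Ss = frac b St.
Proof. by move=> e; apply/eq_fracP; exists 1; [exact: mcar1|rewrite e]. Qed.

Lemma frac_eq a b s t (Ss : S s) (St : S t) :
  a = b -> s = t -> frac a Ss = frac b St.
Proof. by move=> -> e; apply: frac_congr; rewrite e. Qed.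

Definition add_loc (x y : loc) : loc :=
  let p := repr x in let q := repr y in
  frac (p.1 * den q + q.1 * den p) (mcarM (denP p) (denP q)).
Definition opp_loc (x : loc) : loc :=
  let p := repr x in frac (- p.1) (denP p).
Definition mul_loc (x y : loc) : loc :=
  let p := repr x in let q := repr y in
  frac (p.1 * q.1) (mcarM (denP p) (denP q)).

Lemma repr_frac a s (Ss : S s) :
  exists2 u, S u & u * ((repr (frac a Ss)).1 * s) =
                   u * (a * den (repr (frac a Ss))).
Proof.
have : repr (frac a Ss) == mkfrac a Ss %[mod loc] by rewrite reprK.
by rewrite eqmodE => /asboolP.
Qed.

Lemma add_frac a s (Ss : S s) b t (St : S t) :
  add_loc (frac a Ss) (frac b St) = frac (a * t + b * s) (mcarM Ss St).
Proof.
rewrite /add_loc; set p := repr _; set q := repr _.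
have [u Su eu] := repr_frac a Ss; have [v Sv ev] := repr_frac b St.
rewrite -/p in eu; rewrite -/q in ev.
apply/eq_fracP; exists (u * v); first exact: mcarM.
transitivity (v * t * den q * (u * (p.1 * s)) + u * s * den p * (v * (q.1 * t))).
  by ring.
by rewrite eu ev; ring.
Qed.

Lemma mul_frac a s (Ss : S s) b t (St : S t) :
  mul_loc (frac a Ss) (frac b St) = frac (a * b) (mcarM Ss St).
Proof.
rewrite /mul_loc; set p := repr _; set q := repr _.
have [u Su eu] := repr_frac a Ss; have [v Sv ev] := repr_frac b St.
rewrite -/p in eu; rewrite -/q in ev.
apply/eq_fracP; exists (u * v); first exact: mcarM.
transitivity (u * (p.1 * s) * (v * (q.1 * t))); first by ring.
by rewrite eu ev; ring.
Qed.

Lemma opp_frac a s (Ss : S s) : opp_loc (frac a Ss) = frac (- a) Ss.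
Proof.
rewrite /opp_loc; set p := repr _.
have [u Su eu] := repr_frac a Ss; rewrite -/p in eu.
apply/eq_fracP; exists u => //.
by rewrite !mulNr !mulrN eu.
Qed.

Definition inloc (a : R) : loc := frac a (mcar1 S).

Fact loc_addA : associative add_loc.
Proof.
elim/fracW => a s Ss; elim/fracW => b t St; elim/fracW => d u Su.
by rewrite !add_frac; apply: frac_eq; ring.
Qed.
Fact loc_addC : commutative add_loc.
Proof.
elim/fracW => a s Ss; elim/fracW => b t St.
by rewrite !add_frac; apply: frac_eq; ring.
Qed.
Fact loc_add0 : left_id (inloc 0) add_loc.
Proof. by elim/fracW => a s Ss; rewrite add_frac; apply: frac_eq; ring. Qed.
Fact loc_addN : left_inverse (inloc 0) opp_loc add_loc.
Proof.
by elim/fracW => a s Ss; rewrite opp_frac add_frac; apply: frac_congr; ring.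
Qed.
HB.instance Definition _ :=
  GRing.isZmodule.Build loc loc_addA loc_addC loc_add0 loc_addN.

Fact loc_mulA : associative mul_loc.
Proof.
elim/fracW => a s Ss; elim/fracW => b t St; elim/fracW => d u Su.
by rewrite !mul_frac; apply: frac_eq; ring.
Qed.
Fact loc_mulC : commutative mul_loc.
Proof.
elim/fracW => a s Ss; elim/fracW => b t St.
by rewrite !mul_frac; apply: frac_eq; ring.
Qed.
Fact loc_mul1 : left_id (inloc 1) mul_loc.
Proof. by elim/fracW => a s Ss; rewrite mul_frac; apply: frac_eq; ring. Qed.
Fact loc_mulD : left_distributive mul_loc add_loc.
Proof.
elim/fracW => a s Ss; elim/fracW => b t St; elim/fracW => d u Su.
by rewrite !(mul_frac, add_frac); apply: frac_congr; ring.
Qed.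
Fact loc_1neq0 : inloc 1 != inloc 0.
Proof.
apply/eqP => /eq_fracP [u Su]; rewrite !mulr1 mulr0 => u0.
by apply: (@mcar0 _ S); rewrite -u0.
Qed.
HB.instance Definition _ := GRing.Zmodule_isComNzRing.Build loc
  loc_mulA loc_mulC loc_mul1 loc_mulD loc_1neq0.

Fact inloc_zmod_morphism : zmod_morphism inloc.
Proof.
move=> a b; transitivity (add_loc (inloc a) (opp_loc (inloc b))) => //.
by rewrite opp_frac add_frac; apply: frac_eq; ring.
Qed.
HB.instance Definition _ :=
  GRing.isZmodMorphism.Build R loc inloc inloc_zmod_morphism.
Fact inloc_monoid_morphism : monoid_morphism inloc.
Proof.
split=> // a b; transitivity (mul_loc (inloc a) (inloc b)) => //.
by rewrite mul_frac; apply: frac_eq; ring.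
Qed.
HB.instance Definition _ :=
  GRing.isMonoidMorphism.Build R loc inloc inloc_monoid_morphism.

Lemma inloc_is_localization : is_localization S (inloc : {rmorphism R -> loc}).
Proof.
split; [|split].
- move=> s Ss; exists (frac 1 Ss).
  transitivity (mul_loc (inloc s) (frac 1 Ss)) => //.
  by rewrite mul_frac; apply: frac_congr; ring.
- elim/fracW => a s Ss; exists a, s; split=> //.
  transitivity (mul_loc (frac a Ss) (inloc s)) => //.
  by rewrite mul_frac; apply: frac_congr; ring.
- move=> a /eq_fracP[u Su]; rewrite mulr1 mul0r mulr0 => e.
  by exists u.
Qed.

End Localization.

Definition has_inv (R : comNzRingType) (x : R) := exists y, x * y = 1.

(** * The universal property of localization *)

Section Universal.
Variables (R B T : comNzRingType) (S : R -> Prop).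
Variables (phi : {rmorphism R -> B}) (f : {rmorphism R -> T}).
Hypotheses (hphi : is_localization S phi) (fS : forall s, S s -> has_inv (f s)).

Lemma has_inv_inj (x a b : T) : has_inv x -> x * a = x * b -> a = b.
Proof.
move=> [y xy] e; have := congr1 ( *%R y) e.
by rewrite !mulrA ![y * x]mulrC xy !mul1r.
Qed.

Lemma localization_ext (g h : {rmorphism B -> T}) :
  (forall a, g (phi a) = f a) -> (forall a, h (phi a) = f a) -> g =1 h.
Proof.
move=> gf hf b; have [_ [+ _]] := hphi => /(_ b) [a [s [Ss e]]].
apply: (has_inv_inj (fS Ss)).
by rewrite -{1}gf -{1}hf -!rmorphM mulrC e gf hf.
Qed.

(** The value at [b] is pinned down by all presentations of [b] as a fraction at once; every
    identity for [g] then follows by cancelling the units [f s]. *)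
Lemma localization_lift : exists g : {rmorphism B -> T}, forall a, g (phi a) = f a.
Proof.
have [phiS [phi_frac phi0]] := hphi.
have ex b : exists t, forall a s, S s -> b * phi s = phi a -> t * f s = f a.
  have [a [s [Ss e]]] := phi_frac b; have [z fz] := fS Ss.
  exists (f a * z) => a' s' Ss' e'.
  have : phi (a * s' - a' * s) = 0.
    by rewrite rmorphB !rmorphM -e -e'; ring.
  move=> /phi0 [u [Su eu]].
  have : f u * (f a * f s') = f u * (f a' * f s).
    by apply/eqP; rewrite -subr_eq0 -mulrBr -!rmorphM -rmorphB -rmorphM eu rmorph0.
  move=> /(has_inv_inj (fS Su)) e2.
  by rewrite mulrAC e2 -mulrA fz mulr1.
have [g gP] := choice ex.
have gE a : g (phi a) = f a.
  have [a' [s [Ss e]]] := phi_frac (phi a).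
  apply: (has_inv_inj (fS Ss)); rewrite mulrC (gP _ _ _ Ss e).
  have : phi (a * s - a') = 0 by rewrite rmorphB rmorphM e subrr.
  move=> /phi0 [u [Su eu]]; apply: (has_inv_inj (fS Su)).
  apply/eqP; rewrite eq_sym -subr_eq0 -mulrBr -!rmorphM -rmorphB -rmorphM.
  by rewrite [s * a]mulrC eu rmorph0.
have gZ : zmod_morphism g.
  move=> x y; have [a [s [Ss ea]]] := phi_frac x.
  have [b [t [St eb]]] := phi_frac y.
  apply: (has_inv_inj (fS Ss)); apply: (has_inv_inj (fS St)).
  have Sst : phi (a * t - b * s) = (x - y) * phi (s * t).
    by rewrite rmorphB !rmorphM -ea -eb; ring.
  have [a' [s' [Ss' e']]] := phi_frac (x - y).
  apply: (has_inv_inj (fS Ss')).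
  have e1 := gP _ _ _ Ss ea; have e2 := gP _ _ _ St eb.
  have e3 := gP _ _ _ Ss' e'.
  have e4 : f (a' * (s * t)) = f (s' * (a * t - b * s)).
    by rewrite -!gE !rmorphM Sst -e' rmorphM; congr g; ring.
  transitivity (g (x - y) * f s' * f s * f t); first by ring.
  rewrite e3 -mulrA -!rmorphM e4 rmorphM rmorphB !rmorphM -e1 -e2; ring.
have gM : monoid_morphism g.
  split=> [|x y]; first by rewrite -(rmorph1 phi) gE rmorph1.
  have [a [s [Ss ea]]] := phi_frac x.
  have [b [t [St eb]]] := phi_frac y.
  apply: (has_inv_inj (fS Ss)); apply: (has_inv_inj (fS St)).
  have [a' [s' [Ss' e']]] := phi_frac (x * y).
  apply: (has_inv_inj (fS Ss')).
  have e1 := gP _ _ _ Ss ea; have e2 := gP _ _ _ St eb.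
  have e3 := gP _ _ _ Ss' e'.
  have e4 : f (a' * (s * t)) = f (s' * (a * b)).
    by rewrite -!gE !rmorphM -e' -ea -eb; congr g; ring.
  transitivity (g (x * y) * f s' * f s * f t); first by ring.
  rewrite e3 -mulrA -!rmorphM e4 !rmorphM -e1 -e2; ring.
pose gz := GRing.isZmodMorphism.Build B T g gZ.
pose gm := GRing.isMonoidMorphism.Build B T g gM.
pose G : {rmorphism B -> T} := HB.pack g gz gm.
by exists G.
Qed.

End Universal.

(** * Elementary subgroups *)

Definition paired n (i j : 'I_n) : bool :=
  (~~ odd i && (val j == (val i).+1)) || (odd i && (val i == (val j).+1)).

(** The symplectic transvection sending [w] to [w + a <v, w> v], for an arbitrary direction [v]. *)
Definition transv (R : comNzRingType) n (v : 'cV[R]_n) (a : R) : 'M[R]_n :=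
  1%:M + a *: (v *m v^T *m psi R n).

Definition evec (R : comNzRingType) n (i : 'I_n) : 'cV[R]_n := delta_mx i 0.

(* Directions of the symplectic generators: [e_i], and [e_i + e_j] for
   orthogonal [e_i], [e_j]; a hyperbolic pair [(i, j)] just repeats [e_i]. *)
Definition sdir (R : comNzRingType) n (ij : 'I_n * 'I_n) : 'cV[R]_n :=
  if (ij.1 == ij.2) || paired ij.1 ij.2 then evec R ij.1
  else evec R ij.1 + evec R ij.2.

Definition gen (c : Case) n (R : comNzRingType) (ij : 'I_n * 'I_n) (a : R) :
    'M[R]_n :=
  match c with
  | Linear => if ij.1 == ij.2 then 1%:M else 1%:M + a *: delta_mx ij.1 ij.2
  | Symplectic => transv (sdir R ij) a
  end.

(** Inverses need no constructor, as [gen c ij (- a)] inverts [gen c ij a]. *)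
Inductive elem (c : Case) n (R : comNzRingType) : 'M[R]_n -> Prop :=
| elem1 : elem c 1%:M
| elemMgen x ij a : elem c x -> elem c (x *m gen c ij a).

(** * The symplectic form and its transvections *)

Section PsiTheory.
Variables (R : comNzRingType) (n : nat).
Local Notation psi := (psi R n).
Implicit Types u v w z : 'cV[R]_n.

Lemma tr_mx11 (m : 'M[R]_1) : m^T = m.
Proof. by apply/matrixP => i j; rewrite !mxE !ord1. Qed.

(** Writing [psi] as [U - U^T] shows the form to be alternating, not merely antisymmetric, even
    where 2 is a zero divisor. *)
Definition psi_up : 'M[R]_n :=
  \matrix_(i, j) (~~ odd i && (val j == (val i).+1))%:R.

Lemma psiE : psi = psi_up - psi_up^T.
Proof.
apply/matrixP => i j; rewrite !mxE.
case: (altP (val j =P (val i).+1)) => [e|ne]; rewrite ?andbT ?andbF.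
  rewrite e; case: (altP (val i =P (val i).+2)) => [|_]; first by lia.
  by rewrite ?andbF subr0; case: odd.
case: (altP (val i =P (val j).+1)) => [e|_]; last by rewrite !andbF subr0.
by rewrite e /= !andbT sub0r; case: odd => //=; rewrite oppr0.
Qed.

Lemma tr_psi : psi^T = - psi.
Proof. by rewrite psiE linearB /= trmxK opprB. Qed.

Definition om u v : R := (u^T *m psi *m v) 0 0.

Lemma omE u v : u^T *m psi *m v = (om u v)%:M.
Proof. by rewrite [LHS]mx11_scalar. Qed.

Lemma omDl u v w : om (u + v) w = om u w + om v w.
Proof. by rewrite /om linearD /= !mulmxDl mxE. Qed.
Lemma omDr u v w : om u (v + w) = om u v + om u w.
Proof. by rewrite /om mulmxDr mxE. Qed.
Lemma omZl a u v : om (a *: u) v = a * om u v.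
Proof. by rewrite /om linearZ /= -!scalemxAl mxE. Qed.
Lemma omZr a u v : om u (a *: v) = a * om u v.
Proof. by rewrite /om -!scalemxAr mxE. Qed.
Lemma omNl u v : om (- u) v = - om u v.
Proof. by rewrite -scaleN1r omZl mulN1r. Qed.
Lemma omNr u v : om u (- v) = - om u v.
Proof. by rewrite -scaleN1r omZr mulN1r. Qed.
Lemma om_alt v : om v v = 0.
Proof.
have e : v^T *m psi_up^T *m v = v^T *m psi_up *m v.
  by rewrite -[LHS]tr_mx11 !trmx_mul !trmxK mulmxA.
by rewrite /om psiE mulmxBr mulmxBl e subrr mxE.
Qed.
Lemma om_sym u v : om u v = - om v u.
Proof.
have e : u^T *m psi *m v = - (v^T *m psi *m u).
  by rewrite -[LHS]tr_mx11 !trmx_mul trmxK tr_psi mulNmx mulmxN mulmxA.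
by rewrite /om e mxE.
Qed.

Definition omlin := (omDl, omDr, omZl, omZr, omNl, omNr, om_alt).

Lemma psi_paired i j : ~~ paired i j -> psi i j = 0.
Proof.
rewrite /paired mxE negb_or => /andP[h1 h2].
by rewrite (negPf h1) (negPf h2).
Qed.

Lemma psi_paired2 i j : paired i j -> psi i j * psi i j = 1.
Proof.
rewrite /paired mxE; case: ifP => [_ _|_ /= ->]; first by rewrite mulr1.
by rewrite mulrNN mulr1.
Qed.

Lemma paired_uniq (i j k : 'I_n) : paired i j -> paired i k -> j = k.
Proof.
rewrite /paired => h1 h2; apply/val_inj; move: h1 h2.
by move: (odd i) => [] /=; rewrite ?orbF; lia.
Qed.

Lemma paired_sym (i j : 'I_n) : paired i j = paired j i.
Proof.
suff h (k l : 'I_n) : paired k l -> paired l k.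
  by apply/idP/idP; apply: h.
rewrite /paired => /orP [] /andP[ok /eqP e]; rewrite ?e /= ?eqxx ?ok ?orbT //.
by rewrite e /= in ok; rewrite ok.
Qed.

Lemma psi_sum i v : \sum_j psi i j * v j 0 = om (evec R i) v.
Proof.
rewrite /om /evec trmx_delta mxE; apply: eq_bigr => j _; congr (_ * _).
by rewrite -rowE [in RHS]mxE.
Qed.

Lemma om_paired i j v : paired i j -> om (evec R i) v = psi i j * v j 0.
Proof.
move=> p; rewrite -psi_sum (bigD1 j) //= big1 ?addr0 // => k kj.
rewrite psi_paired ?mul0r //; apply: contra kj => p'.
by apply/eqP; apply: paired_uniq p' p.
Qed.

Lemma om_evec i j : om (evec R i) (evec R j) = psi i j.
Proof.
rewrite -psi_sum (bigD1 j) //= big1 ?addr0 => [|k kj]; last first.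
  by rewrite /evec [delta_mx _ _ _ _]mxE (negPf kj) mulr0.
by rewrite /evec [delta_mx _ _ _ _]mxE !eqxx mulr1.
Qed.

Lemma coord_om (i j : 'I_n) v : paired i j -> om (evec R i) v = 0 -> v j 0 = 0.
Proof.
move=> p; rewrite (om_paired _ p) => e.
by rewrite -[LHS]mul1r -(psi_paired2 p) -mulrA e mulr0.
Qed.

Lemma col_sum v : v = \sum_i v i 0 *: evec R i.
Proof.
rewrite [LHS]matrix_sum_delta; apply: eq_bigr => i _.
by rewrite big_ord1.
Qed.

End PsiTheory.

(** The rank-one operator [w |-> om v w *: u], locked so that matrix rewriting treats it as an
    atom. *)
HB.lock Definition rk (R : comNzRingType) n (u v : 'cV[R]_n) : 'M[R]_n :=
  u *m v^T *m psi R n.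

Section Transv.
Variables (R : comNzRingType) (n : nat).
Implicit Types u v w z : 'cV[R]_n.
Local Notation om := (@om R n).

Lemma rkM u v w z : rk u v *m rk w z = om v w *: rk u z.
Proof.
rewrite rk.unlock.
transitivity (u *m (v^T *m psi R n *m w) *m (z^T *m psi R n)).
  by rewrite !mulmxA.
by rewrite omE mul_mx_scalar -scalemxAl mulmxA.
Qed.

Lemma rk_col u v w : rk u v *m w = om v w *: u.
Proof. by rewrite rk.unlock -mulmxA -mulmxA [v^T *m _]mulmxA omE mul_mx_scalar. Qed.

Lemma rkDl u v w : rk (u + v) w = rk u w + rk v w.
Proof. by rewrite rk.unlock !mulmxDl. Qed.
Lemma rkDr u v w : rk u (v + w) = rk u v + rk u w.
Proof. by rewrite rk.unlock linearD /= mulmxDr !mulmxDl. Qed.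
Lemma rkZl a u v : rk (a *: u) v = a *: rk u v.
Proof. by rewrite rk.unlock -!scalemxAl. Qed.
Lemma rkZr a u v : rk u (a *: v) = a *: rk u v.
Proof. by rewrite rk.unlock linearZ /= -!scalemxAr -!scalemxAl. Qed.

Definition rklin := (rkDl, rkDr, rkZl, rkZr).

Lemma transvE v a : transv v a = 1%:M + a *: rk v v.
Proof. by rewrite rk.unlock. Qed.

(** The polarization of [transv]: for orthogonal [u] and [v] it is the cross term of
    [transv (u + v)], a short-root element. *)
Definition transv2 u v : 'M[R]_n := 1%:M + rk u v + rk v u.

Lemma transvZ v a b : transv (b *: v) a = transv v (a * b ^+ 2).
Proof. by rewrite !transvE !rklin !scalerA mulrA. Qed.
Lemma transv0 v : transv v 0 = 1%:M.
Proof. by rewrite transvE scale0r addr0. Qed.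
Lemma transvD v a b : transv v (a + b) = transv v a *m transv v b.
Proof.
rewrite !transvE !(mulmxDl, mulmxDr) -!(scalemxAl, scalemxAr) rkM om_alt.
by rewrite !(mul1mx, mulmx1) scale0r !scaler0 addr0 scalerDl addrA addrAC.
Qed.
Lemma transv_col v a w : transv v a *m w = w + (a * om v w) *: v.
Proof. by rewrite transvE mulmxDl mul1mx -scalemxAl rk_col scalerA. Qed.
Lemma transv2_col u v w : transv2 u v *m w = w + om v w *: u + om u w *: v.
Proof. by rewrite /transv2 !mulmxDl mul1mx !rk_col. Qed.

Local Ltac mxring :=
  apply/matrixP => ? ?; rewrite !mxE; ring.

Lemma transv_add u v a : om u v = 0 ->
  transv (u + v) a = transv u a *m transv v a *m transv2 u (a *: v).
Proof.
move=> uv; have vu : om v u = 0 by rewrite om_sym uv oppr0.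
rewrite /transv2 !transvE !rklin.
rewrite !(mulmxDl, mulmxDr, mul1mx, mulmx1) -!(scalemxAl, scalemxAr).
rewrite ?(rkM, om_alt, uv, vu, scale0r, mulmx0, mul0mx, scaler0, addr0).
rewrite -?(scalemxAl, scalemxAr).
rewrite ?(rkM, om_alt, uv, vu, scale0r, mulmx0, mul0mx, scaler0, addr0).
move: (rk u u) (rk u v) (rk v u) (rk v v) => A B C D.
by mxring.
Qed.

Lemma transv_add2 u v a : om u v = 0 ->
  transv (u + v) a = transv u a *m transv2 u (a *: v) *m transv v a.
Proof.
move=> uv; have vu : om v u = 0 by rewrite om_sym uv oppr0.
rewrite /transv2 !transvE !rklin.
rewrite !(mulmxDl, mulmxDr, mul1mx, mulmx1) -!(scalemxAl, scalemxAr).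
rewrite ?(rkM, om_alt, uv, vu, scale0r, mulmx0, mul0mx, scaler0, addr0).
rewrite -?(scalemxAl, scalemxAr).
rewrite ?(rkM, om_alt, uv, vu, scale0r, mulmx0, mul0mx, scaler0, addr0).
move: (rk u u) (rk u v) (rk v u) (rk v v) => A B C D.
by mxring.
Qed.

(** A Heisenberg relation: additivity in the second argument holds up to the central factor
    [transv u (om v w)]. *)
Lemma transv2_add u v w : om u v = 0 -> om u w = 0 ->
  transv2 u v *m transv2 u w = transv2 u (v + w) *m transv u (om v w).
Proof.
move=> uv uw; have vu : om v u = 0 by rewrite om_sym uv oppr0.
have wu : om w u = 0 by rewrite om_sym uw oppr0.
rewrite /transv2 !transvE !rklin.
rewrite !(mulmxDl, mulmxDr, mul1mx, mulmx1) -!(scalemxAl, scalemxAr).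
rewrite ?(rkM, om_alt, uv, vu, uw, wu, scale0r, mulmx0, mul0mx, scaler0, addr0).
move: (rk u u) (rk u v) (rk v u) (rk u w) (rk w u) (rk v w) => A B C D E F.
by mxring.
Qed.

Lemma transv2C u v : transv2 u v = transv2 v u.
Proof. by rewrite /transv2 addrAC. Qed.
Lemma transv2_0 u : transv2 u 0 = 1%:M.
Proof. by rewrite /transv2 -(scale0r 0) !rklin !scale0r !addr0. Qed.
Lemma transv2_Z u v a : transv2 (a *: u) v = transv2 u (a *: v).
Proof. by rewrite /transv2 !rklin. Qed.
Lemma transv2_same u a : transv2 u (a *: u) = transv u (a + a).
Proof. by rewrite /transv2 transvE !rklin scalerDl addrA. Qed.

Lemma conj_rk (g : 'M[R]_n) u v : g^T *m psi R n *m g = psi R n ->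
  g *m rk u v = rk (g *m u) (g *m v) *m g.
Proof.
move=> gP; rewrite rk.unlock trmx_mul -!mulmxA; congr (_ *m (_ *m _)).
by rewrite -{1}gP !mulmxA.
Qed.

Lemma conj_transv (g : 'M[R]_n) v a : g^T *m psi R n *m g = psi R n ->
  g *m transv v a = transv (g *m v) a *m g.
Proof.
by move=> gP; rewrite !transvE mulmxDl mulmxDr -scalemxAr conj_rk // -scalemxAl
   mul1mx mulmx1.
Qed.

Lemma conj_transv2 (g : 'M[R]_n) u v : g^T *m psi R n *m g = psi R n ->
  g *m transv2 u v = transv2 (g *m u) (g *m v) *m g.
Proof.
by move=> gP; rewrite /transv2 !(mulmxDl, mulmxDr) !conj_rk // mul1mx mulmx1.
Qed.

Lemma transv_Sp v a : Sgrp Symplectic (transv v a).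
Proof.
split.
  by exists (transv v (- a)); rewrite -!transvD subrr addrC subrr transv0.
have e : (transv v a)^T = 1%:M - a *: (psi R n *m v *m v^T).
  rewrite /transv linearD /= trmx1 linearZ /= !trmx_mul trmxK tr_psi.
  by rewrite mulNmx scalerN mulmxA.
rewrite e {}/transv !(mulmxDl, mulmxDr, mulNmx, mul1mx, mulmx1).
rewrite -!(scalemxAl, scalemxAr) !mulmxA.
have -> : psi R n *m v *m v^T *m psi R n *m v *m v^T *m psi R n = 0.
  transitivity (psi R n *m v *m (v^T *m psi R n *m v) *m (v^T *m psi R n)).
    by rewrite !mulmxA.
  by rewrite omE om_alt raddf0 mulmx0 mul0mx.
by rewrite !scaler0 subr0 addrNK.
Qed.

End Transv.

(** * Group laws and base change for [Sgrp] and [elem] *)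

Lemma SgrpM c (R : comNzRingType) n (g h : 'M[R]_n) :
  Sgrp c g -> Sgrp c h -> Sgrp c (g *m h).
Proof.
case: c => /=; first by move=> g1 h1; rewrite det_mulmx g1 h1 mulr1.
move=> [[g' [gg' g'g]] gp] [[h' [hh' h'h]] hp]; split.
  exists (h' *m g'); split.
    by rewrite mulmxA -(mulmxA g) hh' mulmx1.
  by rewrite mulmxA -(mulmxA h') g'g mulmx1.
by rewrite trmx_mul !mulmxA -(mulmxA h^T) -(mulmxA h^T) gp hp.
Qed.

Lemma Sgrp1 c (R : comNzRingType) n : Sgrp c (1%:M : 'M[R]_n).
Proof.
case: c => /=; first exact: det1.
split; last by rewrite trmx1 mul1mx mulmx1.
by exists 1%:M; rewrite mulmx1.
Qed.

Lemma mx_inv_uniq (R : pzRingType) n (g g1 g2 : 'M[R]_n) :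
  g1 *m g = 1%:M -> g *m g2 = 1%:M -> g1 = g2.
Proof. by move=> h1 h2; rewrite -[g1]mulmx1 -h2 mulmxA h1 mul1mx. Qed.

Lemma SgrpV c (R : comNzRingType) n (g g' : 'M[R]_n) :
  Sgrp c g -> g *m g' = 1%:M -> Sgrp c g'.
Proof.
case: c => /=.
  by move=> g1 /(congr1 determinant); rewrite det_mulmx g1 mul1r det1.
move=> [[g'' [gg'' g''g]] gp] gg'; have e := mx_inv_uniq g''g gg'.
rewrite e in gg'' g''g; split; first by exists g.
rewrite -{1}gp !mulmxA -!mulmxA gg' mulmx1 mulmxA -trmx_mul gg' trmx1.
by rewrite mul1mx.
Qed.

Lemma Sgrp_inv c (R : comNzRingType) n (g : 'M[R]_n) : Sgrp c g ->
  exists g', [/\ g *m g' = 1%:M, g' *m g = 1%:M & Sgrp c g'].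
Proof.
case: c => [/= g1|[[g' [gg' g'g]] gp]].
  exists (\adj g); rewrite mul_mx_adj mul_adj_mx g1; split=> //.
  have := congr1 determinant (mul_mx_adj g).
  by rewrite det_mulmx g1 mul1r det1.
exists g'; split=> //; apply: (@SgrpV Symplectic _ _ g) => //.
by split=> //; exists g'.
Qed.

Section ElemBasics.
Variables (c : Case) (n : nat).

Lemma psi_map (R T : comNzRingType) (f : {rmorphism R -> T}) :
  map_mx f (psi R n) = psi T n.
Proof.
by apply/matrixP => i j; rewrite !mxE; do !case: ifP => _;
  rewrite ?rmorphN ?rmorph1 ?rmorph0.
Qed.

Lemma transv_map (R T : comNzRingType) (f : {rmorphism R -> T})
  (v : 'cV[R]_n) a : map_mx f (transv v a) = transv (map_mx f v) (f a).
Proof. by rewrite /transv map_mxD map_mx1 map_mxZ !map_mxM map_trmx psi_map. Qed.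

Lemma sdir_map (R T : comNzRingType) (f : {rmorphism R -> T})
  (ij : 'I_n * 'I_n) : map_mx f (sdir R ij) = sdir T ij.
Proof.
by rewrite /sdir /evec; case: ifP => _; rewrite ?map_mxD !map_delta_mx.
Qed.

Lemma gen_map (R T : comNzRingType) (f : {rmorphism R -> T})
  (ij : 'I_n * 'I_n) a : map_mx f (gen c ij a) = gen c ij (f a).
Proof.
case: c => /=; last by rewrite transv_map sdir_map.
by case: ifP => _; rewrite ?map_mxD map_mx1 // map_mxZ map_delta_mx.
Qed.

Variable (R : comNzRingType).
Implicit Types (ij : 'I_n * 'I_n) (a b : R) (x y : 'M[R]_n).
Local Notation E := (@elem c n R).

Lemma gen0 ij : gen c ij (0 : R) = 1%:M.
Proof. by case: c => /=; [rewrite scale0r addr0; case: ifP|rewrite transv0]. Qed.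

Lemma genD ij a b : gen c ij (a + b) = gen c ij a *m gen c ij b.
Proof.
case: c => /=; last exact: transvD.
case: eqP => [_|ne]; first by rewrite mulmx1.
rewrite mulmxDl !mulmxDr !mulmx1 mul1mx -scalemxAl -scalemxAr mul_delta_mx_0.
  by rewrite !scaler0 addr0 scalerDl addrA addrAC.
by apply/eqP => e; apply: ne.
Qed.

Lemma genV ij a : gen c ij a *m gen c ij (- a) = 1%:M.
Proof. by rewrite -genD subrr gen0. Qed.

Lemma elem_gen ij a : E (gen c ij a).
Proof. by rewrite -[gen _ _ _]mul1mx; apply: elemMgen; apply: elem1. Qed.

Lemma elemM x y : E x -> E y -> E (x *m y).
Proof.
move=> Ex; elim=> [|{}y ij a _ IH]; first by rewrite mulmx1.
by rewrite mulmxA; apply: elemMgen.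
Qed.

Lemma elem_inv x : E x -> exists y, [/\ E y, x *m y = 1%:M & y *m x = 1%:M].
Proof.
elim=> [|{}x ij a _ [y [Ey xy yx]]].
  by exists 1%:M; rewrite mulmx1; split=> //; apply: elem1.
exists (gen c ij (- a) *m y); split.
- by apply: elemM => //; apply: elem_gen.
- by rewrite mulmxA -(mulmxA x) genV mulmx1.
- rewrite mulmxA -(mulmxA _ y) yx mulmx1.
  by have := genV ij (- a); rewrite opprK.
Qed.

Lemma elemV x y : E x -> x *m y = 1%:M -> E y.
Proof.
move=> /elem_inv [z [Ez xz zx]] xy.
by rewrite -(mx_inv_uniq zx xy).
Qed.

Lemma elem_cancelr x y : E y -> E (x *m y) -> E x.
Proof.
move=> /elem_inv [z [Ez yz _]] Exy.
by rewrite -[x]mulmx1 -yz mulmxA; apply: elemM.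
Qed.

Lemma elem_cancell x y : E x -> E (x *m y) -> E y.
Proof.
move=> /elem_inv [z [Ez _ zx]] Exy.
by rewrite -[y]mul1mx -zx -mulmxA; apply: elemM.
Qed.

Lemma gen_Sgrp ij a : Sgrp c (gen c ij a).
Proof.
case: c => /=; last exact: transv_Sp.
case: eqP => [_|/eqP ne]; first exact: det1.
wlog lt : ij ne / (ij.1 < ij.2)%N => [th|].
  have [lt|gt|e] := ltngtP ij.1 ij.2; first exact: th.
    rewrite -det_tr linearD /= trmx1 linearZ /= trmx_delta.
    by apply: (th (ij.2, ij.1)) => //=; rewrite eq_sym.
  by rewrite (val_inj e) eqxx in ne.
rewrite -det_tr det_trig; last first.
  apply/is_trig_mxP => i j ij'; rewrite !mxE.
  case: eqP => [ji|_]; first by rewrite ji ltnn in ij'.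
  case: eqP => [ji|_]; last by rewrite mulr0 addr0.
  case: eqP => [ii|_]; last by rewrite mulr0 addr0.
  by rewrite ii ji ltnNge ltnW in ij'.
rewrite big1 // => i _; rewrite !mxE eqxx.
case: eqP => [->|_]; last by rewrite mulr0 addr0.
by rewrite (negPf ne) mulr0 addr0.
Qed.

Lemma elem_Sgrp x : E x -> Sgrp c x.
Proof.
elim=> [|{}x ij a _ IH]; first exact: Sgrp1.
by apply: SgrpM => //; apply: gen_Sgrp.
Qed.

Lemma comm_subM2 (G : 'M[R]_n -> Prop) x y :
  comm_sub G x -> comm_sub G y -> comm_sub G (x *m y).
Proof.
move=> Gx; elim=> [|y1 z _ IH Cz]; first by rewrite mulmx1.
by rewrite mulmxA; apply: comm_subM.
Qed.

Lemma comm_sub_comm (G : 'M[R]_n -> Prop) x : is_commutator G x -> comm_sub G x.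
Proof. by move=> h; rewrite -[x]mul1mx; apply: comm_subM => //; apply: comm_sub1. Qed.

End ElemBasics.

Lemma elem_map c n (R T : comNzRingType) (f : {rmorphism R -> T}) (x : 'M[R]_n) :
  elem c x -> elem c (map_mx f x).
Proof.
elim=> [|{}x ij a _ IH]; first by rewrite map_mx1; apply: elem1.
by rewrite map_mxM gen_map; apply: elemMgen.
Qed.

Lemma Sgrp_map c n (R T : comNzRingType) (f : {rmorphism R -> T}) (x : 'M[R]_n) :
  Sgrp c x -> Sgrp c (map_mx f x).
Proof.
case: c => /= [e|[[y [xy yx]] xp]]; first by rewrite det_map_mx e rmorph1.
split; last by rewrite map_trmx -(psi_map n f) -!map_mxM xp.
by exists (map_mx f y); rewrite -!map_mxM xy yx map_mx1.
Qed.

(** * Suslin's lemma *)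

Section Suslin.
Variables (R : comNzRingType) (n : nat).
Local Notation E := (@elem Linear n R).

Lemma elem_delta i j a : i != j -> E (1%:M + a *: delta_mx i j).
Proof.
by move=> ij; have := @elem_gen Linear n R (i, j) a; rewrite /= (negPf ij).
Qed.

Lemma rank1_mulr (x : 'cV[R]_n) (y z : 'rV[R]_n) : y *m x = 0 ->
  (1%:M + x *m y) *m (1%:M + x *m z) = 1%:M + x *m (y + z).
Proof.
move=> yx; rewrite mulmxDl mul1mx [in X in _ + X]mulmxDr mulmx1.
rewrite -mulmxA [y *m (_ *m _)]mulmxA yx mul0mx mulmx0 addr0 mulmxDr.
by rewrite addrA addrAC.
Qed.

Lemma rank1_mull (x z : 'cV[R]_n) (y : 'rV[R]_n) : y *m z = 0 ->
  (1%:M + x *m y) *m (1%:M + z *m y) = 1%:M + (x + z) *m y.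
Proof.
move=> yz; rewrite mulmxDl mul1mx [in X in _ + X]mulmxDr mulmx1.
rewrite -mulmxA [y *m (_ *m _)]mulmxA yz mul0mx mulmx0 addr0 mulmxDl.
by rewrite addrA addrAC.
Qed.

Lemma elem_sumr (I : finType) (x : 'cV[R]_n) (F : I -> 'rV[R]_n) :
  (forall i, F i *m x = 0) -> (forall i, E (1%:M + x *m F i)) ->
  E (1%:M + x *m \sum_i F i).
Proof.
move=> F0 FE; suff [] : (\sum_i F i) *m x = 0 /\ E (1%:M + x *m \sum_i F i) by [].
elim/big_ind: _ => [|y z [y0 yE] [z0 zE]|i _]; last by [].
  by rewrite mul0mx mulmx0 addr0; split=> //; apply: elem1.
by rewrite mulmxDl y0 z0 addr0 -rank1_mulr //; split=> //; apply: elemM.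
Qed.

Lemma elem_suml (I : finType) (y : 'rV[R]_n) (F : I -> 'cV[R]_n) :
  (forall i, y *m F i = 0) -> (forall i, E (1%:M + F i *m y)) ->
  E (1%:M + (\sum_i F i) *m y).
Proof.
move=> F0 FE; suff [] : y *m (\sum_i F i) = 0 /\ E (1%:M + (\sum_i F i) *m y) by [].
elim/big_ind: _ => [|x z [x0 xE] [z0 zE]|i _]; last by [].
  by rewrite mul0mx mulmx0 addr0; split=> //; apply: elem1.
by rewrite mulmxDr x0 z0 addr0 -rank1_mull //; split=> //; apply: elemM.
Qed.

Lemma row_delta_col k (x : 'cV[R]_n) : delta_mx 0 k *m x = (x k 0)%:M :> 'M_1.
Proof. by rewrite -rowE [LHS]mx11_scalar mxE. Qed.

Lemma row_col_delta k (y : 'rV[R]_n) : y *m delta_mx k 0 = (y 0 k)%:M :> 'M_1.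
Proof. by rewrite -colE [LHS]mx11_scalar mxE. Qed.

Lemma elem_col k (x : 'cV[R]_n) : x k 0 = 0 -> E (1%:M + x *m delta_mx 0 k).
Proof.
move=> xk; rewrite [x in x *m _]col_sum; apply: elem_suml => i.
  rewrite -scalemxAr row_delta_col mxE eqxx andbT.
  by case: eqP => [<-|_]; rewrite ?xk ?scale0r // raddf0 scaler0.
rewrite -scalemxAl mul_delta_mx; case: (eqVneq i k) => [->|ik].
  by rewrite xk scale0r addr0; apply: elem1.
exact: elem_delta.
Qed.

Lemma elem_tr (x : 'M[R]_n) : E x -> E x^T.
Proof.
elim=> [|{}x [i j] a _ IH]; first by rewrite trmx1; apply: elem1.
rewrite trmx_mul; apply: elemM => //=.
case: eqVneq => [_|ij]; first by rewrite trmx1; apply: elem1.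
rewrite linearD /= trmx1 linearZ /= trmx_delta; apply: elem_delta.
by rewrite eq_sym.
Qed.

Lemma elem_row k (y : 'rV[R]_n) : y 0 k = 0 -> E (1%:M + delta_mx k 0 *m y).
Proof.
move=> yk; rewrite -[X in E X]trmxK; apply: elem_tr.
rewrite linearD /= trmx1 trmx_mul trmx_delta; apply: elem_col.
by rewrite mxE.
Qed.

(** With [a = x e_k^T] and [b = e_k z] one has [a a = b b = b a = 0] and [a b = x z], so [1 + x z]
    is the commutator of the elementary matrices [1 + a] and [1 + b]. *)
Lemma elem_sparse k (x : 'cV[R]_n) (z : 'rV[R]_n) :
  x k 0 = 0 -> z 0 k = 0 -> z *m x = 0 -> E (1%:M + x *m z).
Proof.
move=> xk zk zx.
have Ea := elem_col xk; have Eb := elem_row zk.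
set a := x *m delta_mx 0 k in Ea; set b := delta_mx k 0 *m z in Eb.
have aa : a *m a = 0.
  rewrite /a mulmxA -[x *m _ *m x]mulmxA row_delta_col xk raddf0.
  by rewrite mulmx0 mul0mx.
have bb : b *m b = 0.
  by rewrite /b mulmxA -[_ *m _ *m delta_mx _ _]mulmxA row_col_delta zk raddf0
     mulmx0 mul0mx.
have ba : b *m a = 0.
  by rewrite /a /b mulmxA -[_ *m _ *m x]mulmxA zx mulmx0 mul0mx.
have ab : a *m b = x *m z.
  rewrite /a /b mulmxA -[_ *m _ *m delta_mx _ _]mulmxA mul_delta_mx.
  by rewrite [delta_mx 0 0]mx11_scalar mxE !eqxx mulmx1.
apply: (elem_cancelr (elemM Eb Ea)).
suff -> : (1%:M + x *m z) *m ((1%:M + b) *m (1%:M + a)) =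
          (1%:M + a) *m (1%:M + b) by exact: elemM.
rewrite -ab !(mulmxDl, mulmxDr, mul1mx, mulmx1) ba !addr0.
rewrite -[a *m b *m a]mulmxA ba mulmx0 -[a *m b *m b]mulmxA bb !(mulmx0, addr0).
by move: (a *m b) => d; clearbody a b; apply/matrixP => i j; rewrite !mxE; ring.
Qed.

Lemma minor_row_ann i j (x : 'cV[R]_n) :
  (x j 0 *: delta_mx 0 i - x i 0 *: delta_mx 0 j) *m x = 0 :> 'M_1.
Proof.
rewrite mulmxBl -!scalemxAl !row_delta_col !scale_scalar_mx.
by rewrite [x j 0 * _]mulrC subrr.
Qed.

(** The row vanishes at [k]. Splitting [x_k e_k] off [x] leaves a column vanishing at [k], suited to
    [elem_sparse]; the split-off part falls under [elem_row]. *)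
Lemma elem_suslin_pair (i j k : 'I_n) (x : 'cV[R]_n) (a : R) :
  i != k -> j != k ->
  E (1%:M + x *m (a *: (x j 0 *: delta_mx 0 i - x i 0 *: delta_mx 0 j))).
Proof.
move=> ik jk; set z := a *: _.
have zk : z 0 k = 0.
  rewrite !mxE /= ![k == _]eq_sym (negPf ik) (negPf jk). by rewrite !mulr0n !mulr0 subrr mulr0.
have zx : z *m x = 0.
  by rewrite /z -scalemxAl minor_row_ann scaler0.
have ze : z *m (x k 0 *: (delta_mx k 0 : 'cV[R]_n)) = 0.
  by rewrite -scalemxAr row_col_delta zk raddf0 scaler0.
rewrite -[x in x *m z](subrK (x k 0 *: delta_mx k 0)) -rank1_mull //.
apply: elemM.
  apply: (@elem_sparse k) => //.
    by rewrite !mxE /= !eqxx mulr1 subrr.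
  by rewrite mulmxBr zx ze subrr.
by rewrite -scalemxAl scalemxAr; apply: elem_row; rewrite mxE zk mulr0.
Qed.

Hypothesis n3 : (3 <= n)%N.

Lemma third_index (i j : 'I_n) : exists k, (i != k) && (j != k).
Proof.
pose f (q : 'I_3) : 'I_n := widen_ord n3 q.
suff [q]: exists q : 'I_3, (val i != q) && (val j != q) by exists (f q).
apply/existsP; apply: contraT; rewrite negb_exists => /forallP h.
have := h (inord 0); have := h (inord 1); have := h (inord 2).
by rewrite !inordK //; lia.
Qed.

(* Suslin: [s y = sum_(i,j) y_i u_j (x_j e_i - x_i e_j)], and each summand
   kills [x] and misses a third coordinate. *)
Lemma elem_suslin (x : 'cV[R]_n) (y u : 'rV[R]_n) (s a : R) :
  y *m x = 0 -> u *m x = s%:M -> E (1%:M + (s * a) *: (x *m y)).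
Proof.
move=> yx ux.
have key : (s * a) *: y = \sum_(ij : 'I_n * 'I_n)
    ((a * (y 0 ij.1 * u 0 ij.2)) *:
      (x ij.2 0 *: delta_mx 0 ij.1 - x ij.1 0 *: delta_mx 0 ij.2)).
  have us : \sum_j u 0 j * x j 0 = s.
    by have := congr1 (fun m : 'M_1 => m 0 0) ux; rewrite !mxE eqxx.
  have ys : \sum_j y 0 j * x j 0 = 0.
    by have := congr1 (fun m : 'M_1 => m 0 0) yx; rewrite !mxE.
  apply/rowP => l; rewrite summxE mxE.
  rewrite -(pair_bigA _ (fun i j => ((a * (y 0 i * u 0 j)) *:
      (x j 0 *: delta_mx 0 i - x i 0 *: delta_mx 0 j)) 0 l)) /=.
  transitivity (\sum_i \sum_j ((a * y 0 i * (l == i)%:R) * (u 0 j * x j 0) -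
      (a * y 0 i * x i 0) * (u 0 j * (l == j)%:R))).
    under eq_bigr do rewrite sumrB -!mulr_sumr us.
    rewrite sumrB -!mulr_suml.
    have -> : \sum_i a * y 0 i * x i 0 = 0.
      under eq_bigr do rewrite -mulrA.
      by rewrite -mulr_sumr ys mulr0.
    rewrite mul0r subr0 (bigD1 l) //= eqxx big1 ?addr0 => [|i il].
      by rewrite mulr1n; ring.
    by rewrite eq_sym (negPf il) mulr0.
  apply: eq_bigr => i _; apply: eq_bigr => j _.
  by rewrite !mxE /=; ring.
rewrite scalemxAr key; apply: elem_sumr => -[i j] /=.
  by rewrite -scalemxAl minor_row_ann scaler0.
have [k /andP[ik jk]] := third_index i j.
exact: (elem_suslin_pair _ _ ik jk).
Qed.

(** The form for a unimodular row instead of a unimodular column, as met in the reduction over local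
    rings. *)
Lemma elem_suslin_tr (x u : 'cV[R]_n) (y : 'rV[R]_n) :
  y *m x = 0 -> y *m u = 1%:M -> E (1%:M + x *m y).
Proof.
move=> yx yu; rewrite -[X in E X]trmxK; apply: elem_tr.
rewrite linearD /= trmx1 trmx_mul.
have := @elem_suslin y^T x^T u^T 1 1; rewrite mulr1 scale1r; apply.
  by rewrite -trmx_mul yx trmx0.
by rewrite -trmx_mul yu trmx1.
Qed.

(** The Steinberg relation [e_ij(a) = [e_ik(a), e_kj(1)]] with a third index [k]. *)
Lemma rank1_comm (i j : 'I_n) a : i != j ->
  comm_sub (Sgrp Linear (R := R) (n := n)) (1%:M + a *: delta_mx i j).
Proof.
move=> ij; have [k /andP[ik jk]] := third_index i j.
have gS p q b : p != q -> Sgrp Linear (1%:M + b *: delta_mx p q : 'M[R]_n).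
  by move=> pq; apply: elem_Sgrp; apply: elem_delta.
have gV p q b : p != q ->
    (1%:M + b *: delta_mx p q) *m (1%:M - b *: delta_mx p q) = 1%:M :> 'M[R]_n.
  move=> pq; have := @genV Linear n R (p, q) b; rewrite /= (negPf pq).
  by rewrite scaleNr.
have gV' p q b : p != q ->
    (1%:M - b *: delta_mx p q) *m (1%:M + b *: delta_mx p q) = 1%:M :> 'M[R]_n.
  by move=> pq; have := gV p q (- b) pq; rewrite !scaleNr opprK.
apply: comm_sub_comm.
exists (1%:M + a *: delta_mx i k), (1%:M + 1 *: delta_mx k j).
exists (1%:M - a *: delta_mx i k), (1%:M - 1 *: delta_mx k j).
have kj : k != j by rewrite eq_sym.
do 6?[split; first by [apply: gS|apply: gV|apply: gV']].
set A := _ *: delta_mx i k; set B := _ *: delta_mx k j.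
have AB : A *m B = a *: delta_mx i j.
  by rewrite -scalemxAl -scalemxAr mul_delta_mx scale1r.
have BA : B *m A = 0.
  by rewrite -scalemxAl -scalemxAr mul_delta_mx_0 ?scaler0 // eq_sym.
have AA : A *m A = 0.
  by rewrite -scalemxAl -scalemxAr mul_delta_mx_0 ?scaler0 // eq_sym.
have BB : B *m B = 0.
  by rewrite -scalemxAl -scalemxAr mul_delta_mx_0 ?scaler0 // eq_sym.
rewrite -AB !(mulmxDl, mulmxDr, mulNmx, mulmxN, mul1mx, mulmx1, AA, BB, BA).
rewrite -[A *m B *m A]mulmxA -[A *m B *m B]mulmxA BA BB.
rewrite !(mulmx0, mul0mx, oppr0, addr0).
rewrite -?[A *m B *m A]mulmxA -?[A *m B *m B]mulmxA ?BA ?BB.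
rewrite ?(mulmx0, mul0mx, oppr0, addr0).
clearbody A B; move: (A *m B) => C.
by apply/matrixP => p q; rewrite !mxE; ring.
Qed.

End Suslin.

(** * Symplectic transvections *)

Section Symplectic.
Variables (R : comNzRingType) (n : nat).
Local Notation E := (@elem Symplectic n R).
Local Notation e := (@evec R n).
Implicit Types (i j k l : 'I_n) (u v w : 'cV[R]_n).

Lemma elem_transv_evec i a : E (transv (e i) a).
Proof.
by have := @elem_gen Symplectic n R (i, i) a; rewrite /= /sdir /= eqxx.
Qed.

Lemma elem_transv2_evec i j a : ~~ paired i j -> E (transv2 (e i) (a *: e j)).
Proof.
move=> ij; have [<-|ne] := eqVneq i j.
  by rewrite transv2_same; apply: elem_transv_evec.
have eij : om (e i) (e j) = 0 by rewrite om_evec psi_paired.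
have := @elem_gen Symplectic n R (i, j) a.
rewrite /= /sdir /= (negPf ne) (negPf ij) /= (transv_add _ eij).
by apply: elem_cancell; apply: elemM; apply: elem_transv_evec.
Qed.

(** Expand [v] in the basis: its coordinate at the partner of [i] vanishes, the other terms are
    covered by [elem_transv2_evec], and the central factors of [transv2_add] are transvections along
    [e i]. *)
Lemma elem_transv2_om0 i v : om (e i) v = 0 -> E (transv2 (e i) v).
Proof.
move=> iv; rewrite (col_sum v).
suff [] : om (e i) (\sum_j v j 0 *: e j) = 0 /\
          E (transv2 (e i) (\sum_j v j 0 *: e j)) by [].
elim/big_ind: _ => [|x z [x0 xE] [z0 zE]|j _].
- by rewrite -(scale0r 0) omZr mul0r scale0r transv2_0; split=> //; apply: elem1.
- rewrite omDr x0 z0 addr0; split=> //.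
  apply: (@elem_cancelr _ _ _ _ (transv (e i) (om x z))).
    exact: elem_transv_evec.
  by rewrite -transv2_add //; apply: elemM.
- rewrite omZr om_evec; case: (boolP (paired i j)) => ij.
    rewrite (coord_om ij iv) mul0r scale0r transv2_0; split=> //.
    exact: elem1.
  by rewrite psi_paired // mulr0; split=> //; apply: elem_transv2_evec.
Qed.

(* With [g = transv2 (e l) v] one has [g (e k) = e k + v] up to the sign of
   [v], so that [transv (e k + v) a] is conjugate to a generator under [g]. *)
Lemma elem_transv_orth k l v a : paired k l ->
  om (e k) v = 0 -> om (e l) v = 0 -> E (transv v a).
Proof.
move=> kl kv lv.
have lk : paired l k by rewrite paired_sym.
have gE := elem_transv2_om0 lv; set g := transv2 _ _ in gE.
pose b := psi R n l k.
have gk : g *m e k = e k + b *: v.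
  by rewrite transv2_col om_evec -/b om_sym kv oppr0 scale0r addr0.
have /= [_ gp] := elem_Sgrp gE.
have bkv : om (e k) (b *: v) = 0 by rewrite omZr kv mulr0.
have : E (transv (e k + b *: v) a).
  rewrite -gk; apply: (elem_cancelr gE); rewrite -conj_transv //.
  by apply: elemM => //; apply: elem_transv_evec.
rewrite (transv_add _ bkv) transvZ expr2 (psi_paired2 R lk) mulr1 => h.
apply: (elem_cancell (elem_transv_evec k a)).
apply: (elem_cancelr _ h); apply: elem_transv2_om0.
by rewrite omZr bkv mulr0.
Qed.

(** Split [v] into its part [v1] in the plane [(i0, i1)] and the rest. Then [v1] is orthogonal to
    the plane [(i2, i3)] and the rest to [(i0, i1)], so [elem_transv_orth] serves both; only the
    cross term remains. *)
Lemma elem_transv (n4 : (4 <= n)%N) v a : E (transv v a).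
Proof.
pose i0 := widen_ord n4 (inord 0 : 'I_4).
pose i1 := widen_ord n4 (inord 1 : 'I_4).
pose i2 := widen_ord n4 (inord 2 : 'I_4).
pose i3 := widen_ord n4 (inord 3 : 'I_4).
have p01 : paired i0 i1 by rewrite /paired /= !inordK.
have p23 : paired i2 i3 by rewrite /paired /= !inordK.
have p10 : paired i1 i0 by rewrite paired_sym.
have p32 : paired i3 i2 by rewrite paired_sym.
have np20 : ~~ paired i2 i0 by rewrite /paired /= !inordK.
have np21 : ~~ paired i2 i1 by rewrite /paired /= !inordK.
have np30 : ~~ paired i3 i0 by rewrite /paired /= !inordK.
have np31 : ~~ paired i3 i1 by rewrite /paired /= !inordK.
pose v1 := v i0 0 *: e i0 + v i1 0 *: e i1.
have v1v : v = v1 + (v - v1) by rewrite addrC subrK.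
have o0 : om (e i0) (v - v1) = 0.
  by rewrite !omlin (om_paired _ p01) !om_evec; ring.
have o1 : om (e i1) (v - v1) = 0.
  by rewrite !omlin (om_paired _ p10) !om_evec; ring.
have o10 : om v1 (v - v1) = 0.
  by rewrite omDl !omZl o0 o1 !mulr0 addr0.
have E1 b : E (transv v1 b).
  apply: (elem_transv_orth _ p23); rewrite !omlin !om_evec !psi_paired //; ring.
have E2 b : E (transv (v - v1) b) by apply: (elem_transv_orth _ p01).
rewrite v1v (transv_add _ o10); apply: elemM; first exact: elemM.
move: (v - v1) o0 o1 E2 => w o0 o1 E2 {o10 v1v}.
have w0 b : om w (b *: e i0) = 0 by rewrite omZr om_sym o0 oppr0 mulr0.
have w1 b : om w (b *: e i1) = 0 by rewrite omZr om_sym o1 oppr0 mulr0.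
have aw b : om (a *: w) (b *: e i0) = 0 by rewrite omZl w0 mulr0.
have aw' b : om (a *: w) (b *: e i1) = 0 by rewrite omZl w1 mulr0.
(* The cross term is expanded along the two coordinates of [v1]. These are not orthogonal to each
   other, and the correction is a transvection along [a *: w], elementary by [E2]. *)
rewrite transv2C /v1; set b := om (v i0 0 *: e i0) (v i1 0 *: e i1).
apply: (@elem_cancelr _ _ _ _ (transv (a *: w) b)).
  by rewrite transvZ.
rewrite -transv2_add //; apply: elemM; rewrite transv2C transv2_Z;
  by apply: elem_transv2_om0; rewrite !omZr ?o0 ?o1 !mulr0.
Qed.

Hypothesis n6 : (6 <= n)%N.
Hypothesis n_even : ~~ odd n.

Lemma partner i : exists j, paired i j.
Proof.
case: (boolP (odd i)) => oi.
  have h : (i.-1 < n)%N by apply: leq_ltn_trans (leq_pred _) (ltn_ord i).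
  exists (Ordinal h); rewrite /paired oi /= prednK ?eqxx //.
  by case: (val i) oi.
have h : (i.+1 < n)%N.
  rewrite ltn_neqAle ltn_ord andbT; apply/eqP => ei.
  by move: n_even; rewrite -ei /= oi.
by exists (Ordinal h); rewrite /paired oi /= eqxx.
Qed.

Lemma third_plane i j : exists k,
  [/\ i != k, j != k, ~~ paired i k & ~~ paired j k].
Proof.
pose f (q : 'I_6) : 'I_n := widen_ord n6 q.
suff [q /and4P h]: exists q : 'I_6, [&& i != f q, j != f q, ~~ paired i (f q) & ~~ paired j (f q)].
  by exists (f q).
apply/existsP; apply: contraT; rewrite negb_exists => /forallP h.
have := h (inord 0); have := h (inord 2); have := h (inord 4).
rewrite /paired -!val_eqE /= !inordK //.
by case: (boolP (odd i)); case: (boolP (odd j)) => /=; rewrite ?orbF; lia.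
Qed.

Local Notation S := (Sgrp Symplectic (R := R) (n := n)).

(** Here [x = g y g^-1], so that [x y'] is the commutator [[g, y]]. *)
Lemma conj_comm (g x y y' : 'M[R]_n) : S g -> S y ->
  y *m y' = 1%:M -> g *m y = x *m g -> comm_sub S (x *m y').
Proof.
move=> gS yS yy' gyx; have [g' [gg' g'g _]] := Sgrp_inv gS.
have [y'' [yy'' y''y _]] := Sgrp_inv yS.
have ey := mx_inv_uniq y''y yy'.
apply: comm_sub_comm; exists g, y, g', y'; rewrite -ey; split=> //.
do 5?split=> //.
by rewrite gyx -(mulmxA x) gg' mulmx1.
Qed.

(* [g = transv2 (e i) w] with [w] dual to [e j] moves [e j] to [e i + e j]. *)
Lemma shear i j : ~~ paired i j -> i != j -> exists2 g, S g &
  g *m e j = e i + e j /\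
  forall l, i != l -> j != l -> ~~ paired i l -> ~~ paired j l -> g *m e l = e l.
Proof.
move=> nij ij; have [j' jj'] := partner j.
have j'j : paired j' j by rewrite paired_sym.
have nij' : ~~ paired i j'.
  apply/negP => p; move/negP: ij; apply; apply/eqP.
  by apply: (@paired_uniq _ j' i j); rewrite // paired_sym.
have eij : om (e i) (e j) = 0 by rewrite om_evec psi_paired.
have eij' : om (e i) (e j') = 0 by rewrite om_evec psi_paired.
pose b := psi R n j' j.
exists (transv2 (e i) (b *: e j')).
  by apply: elem_Sgrp; apply: elem_transv2_om0; rewrite omZr eij' mulr0.
split.
  rewrite transv2_col eij scale0r addr0 omZl om_evec -/b psi_paired2 //.
  by rewrite scale1r addrC.
move=> l il jl nil njl.
have nj'l : ~~ paired j' l.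
  apply/negP => p; move/negP: jl; apply; apply/eqP.
  exact: paired_uniq j'j p.
by rewrite transv2_col omZl !om_evec !psi_paired // mulr0 !scale0r !addr0.
Qed.

(** Take [k] in a third plane and a shear [g] fixing [e i] and sending [e k] to [e j + e k]; the
    matrix is then [[g, transv2 (e i) (a *: e k)]]. The third plane is the reason for [n >= 6]. *)
Lemma comm_transv2 i j a : i != j -> ~~ paired i j ->
  comm_sub S (transv2 (e i) (a *: e j)).
Proof.
move=> ij nij; have [k [ik jk nik njk]] := third_plane i j.
have [g gS [gk gl]] := shear njk jk.
have gi : g *m e i = e i by apply: gl; rewrite // 1?eq_sym // paired_sym.
have eik : om (e i) (e k) = 0 by rewrite om_evec psi_paired.
have eij : om (e i) (e j) = 0 by rewrite om_evec psi_paired.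
have ejk : om (e j) (e k) = 0 by rewrite om_evec psi_paired.
have zik b : om (e i) (b *: e k) = 0 by rewrite omZr eik mulr0.
have TT : transv2 (e i) (a *: e k) *m transv2 (e i) (- a *: e k) = 1%:M.
  rewrite transv2_add // omZl omZr om_alt !mulr0 transv0 mulmx1.
  by rewrite -scalerDl subrr scale0r transv2_0.
have TS : S (transv2 (e i) (a *: e k)).
  by apply: elem_Sgrp; apply: elem_transv2_om0.
have := conj_comm gS TS TT; rewrite conj_transv2 ?gS.2 // gi -scalemxAr gk.
move=> /(_ _ erefl); rewrite transv2_add //; last first.
  by rewrite scalerDr omDr zik omZr eij mulr0 addr0.
rewrite scalerDr omDl !omZl !omZr ejk om_alt !mulr0 addr0 transv0 mulmx1.
by rewrite -addrA -scalerDl subrr scale0r addr0.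
Qed.

(** If the shear [g] sends [e j] to [e i + e j], then [[g, transv (e j) a]] equals [transv (e i) a]
    times [transv2 (e i) (a *: e j)], and [comm_transv2] removes the second factor. *)
Lemma comm_transv_evec i a : comm_sub S (transv (e i) a).
Proof.
have [j [ij _ nij _]] := third_plane i i.
have [g gS [gj _]] := shear nij ij.
have eij : om (e i) (e j) = 0 by rewrite om_evec psi_paired.
have zij b : om (e i) (b *: e j) = 0 by rewrite omZr eij mulr0.
have TT : transv (e j) a *m transv (e j) (- a) = 1%:M.
  by rewrite -transvD subrr transv0.
have := conj_comm gS (transv_Sp _ _) TT; rewrite conj_transv ?gS.2 // gj.
move=> /(_ _ erefl) h.
have C2 := comm_transv2 (- a) ij nij.
have := comm_subM2 h C2.
rewrite transv_add2 // -(mulmxA _ (transv (e j) a)) TT mulmx1 -mulmxA.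
rewrite transv2_add // -scalerDl subrr scale0r transv2_0 mul1mx.
by rewrite omZl omZr om_alt !mulr0 transv0 mulmx1.
Qed.

End Symplectic.

(** * Normality, perfectness, local rings *)

Section ElemTheory.
Variables (c : Case) (n : nat).
Hypothesis hn : dim_ok c n.

Lemma elem_comm (R : comNzRingType) (x : 'M[R]_n) :
  elem c x -> comm_sub (Sgrp c (R := R) (n := n)) x.
Proof.
elim=> [|{}x [i j] a _ IH]; first exact: comm_sub1.
apply: comm_subM2 => //; case: c hn => [n3|[n_even n6]] /=.
  by case: eqVneq => [_|ij]; [apply: comm_sub1|apply: rank1_comm].
rewrite /sdir /=; case: ifP => [_|/negbT]; first exact: comm_transv_evec.
rewrite negb_or => /andP[ij nij]; rewrite transv_add; last first.
  by rewrite om_evec psi_paired.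
apply: comm_subM2; last exact: comm_transv2.
by apply: comm_subM2; apply: comm_transv_evec.
Qed.

(** In the linear case the conjugate is [1 + a (g e_i)(e_j g')]: the row kills the column, and the
    row [e_i g'] shows the column to be unimodular, so Suslin's lemma applies with [s = 1]. In the
    symplectic case it is again a transvection. *)
Lemma elem_conj_gen (R : comNzRingType) (g g' : 'M[R]_n) ij a :
  Sgrp c g -> g *m g' = 1%:M -> elem c (g *m gen c ij a *m g').
Proof.
move=> gS gg'; have [g'' [gg'' g''g _]] := Sgrp_inv gS.
have e := mx_inv_uniq g''g gg'; rewrite {g'' gg''}e in g''g.
case: c hn gS => [n3 gS|[n_even n6] [_ gp]] /=; last first.
  rewrite conj_transv // -mulmxA gg' mulmx1; apply: elem_transv.
  exact: leq_trans n6.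
case: ij => i j /=; case: eqVneq => [_|ij].
  by rewrite mulmx1 gg'; apply: elem1.
rewrite mulmxDr mulmxDl mulmx1 gg' -scalemxAr -scalemxAl.
rewrite -(mul_delta_mx (0 : 'I_1)) !mulmxA -[_ *m _ *m g']mulmxA -[a]mul1r.
apply: (@elem_suslin _ _ n3 _ _ (delta_mx 0 i *m g')).
  by rewrite mulmxA -(mulmxA _ g') g''g mulmx1 mul_delta_mx_0 // eq_sym.
by rewrite mulmxA -(mulmxA _ g') g''g mulmx1 mul_delta_mx [delta_mx 0 0]mx11_scalar mxE.
Qed.

Lemma elem_conj (R : comNzRingType) (g g' x : 'M[R]_n) :
  Sgrp c g -> g *m g' = 1%:M -> elem c x -> elem c (g *m x *m g').
Proof.
move=> gS gg'; have [g'' [gg'' g''g _]] := Sgrp_inv gS.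
have e := mx_inv_uniq g''g gg'; rewrite {g'' gg''}e in g''g.
elim=> [|{}x ij a _ IH]; first by rewrite mulmx1 gg'; apply: elem1.
have -> : g *m (x *m gen c ij a) *m g' = (g *m x *m g') *m (g *m gen c ij a *m g').
  by rewrite !mulmxA -(mulmxA _ g' g) g''g mulmx1.
by apply: elemM => //; apply: elem_conj_gen.
Qed.

End ElemTheory.

Definition local_ring (R : comNzRingType) :=
  forall x y : R, has_inv (x + y) -> has_inv x \/ has_inv y.

(** * Elementary reduction over a local ring *)

Section Local.
Variables (R : comNzRingType) (n : nat).
Hypothesis locR : local_ring R.

Lemma has_inv0 : ~ has_inv (0 : R).
Proof. by move=> [y]; rewrite mul0r => /esym/eqP; rewrite oner_eq0. Qed.

Lemma has_inv1 : has_inv (1 : R).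
Proof. by exists 1; rewrite mulr1. Qed.

Lemma has_invMr (x y : R) : has_inv (x * y) -> has_inv y.
Proof. by move=> [z e]; exists (x * z); rewrite -e; ring. Qed.

Lemma has_invN (x : R) : has_inv x -> has_inv (- x).
Proof. by move=> [y xy]; exists (- y); rewrite mulrNN. Qed.

Lemma has_inv_addl (x y : R) : ~ has_inv x -> has_inv y -> has_inv (x + y).
Proof.
move=> nx y_inv; have := @locR (x + y) (- x).
rewrite addrAC subrr add0r => /(_ y_inv) [//|/has_invN].
by rewrite opprK.
Qed.

Lemma has_inv_sum (I : finType) (F : I -> R) :
  has_inv (\sum_i F i) -> exists i, has_inv (F i).
Proof.
elim/big_ind: _ => [/has_inv0 //|x y hx hy /locR []//|i _ h].
by exists i.
Qed.

Lemma col_mx_ext (g h : 'M[R]_n) :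
  (forall i, g *m evec R i = h *m evec R i) -> g = h.
Proof.
move=> gh; apply/matrixP => k i; have := congr1 (fun v : 'cV[R]_n => v k 0) (gh i).
by rewrite /evec -!colE !mxE.
Qed.

(** Columns are cleared from left to right. If [v = g e_l] has a unit below the diagonal, there is a
    row [y] with [y v = y e_l = 1] that vanishes on the earlier basis vectors, and [1 + (e_l - v) y]
    carries [v] to [e_l]. A unit found only on the diagonal is first added to the next row. *)
Lemma local_SL : (3 <= n)%N -> forall g : 'M[R]_n, \det g = 1 -> elem Linear g.
Proof.
move=> n3 g.
suff h d k (g1 : 'M[R]_n) : (k + d).+1 = n -> \det g1 = 1 ->
    (forall i : 'I_n, (i < k)%N -> g1 *m evec R i = evec R i) ->
    elem Linear g1.
  by move=> gS; apply: (h n.-1 0%N) => //; rewrite add0n prednK // ltnW // ltnW.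
elim: d k g1 => [|d IH] k {}g kd gS gk.
  (* Only the last column is left, so [g = 1 + x e_l^T]; the determinant forces the last diagonal
     entry to be 1, that is [x_l = 0]. *)
  have kn : (k < n)%N by lia.
  pose l := Ordinal kn; pose x := g *m evec R l - evec R l.
  have gE : g = 1%:M + x *m delta_mx 0 l.
    apply: col_mx_ext => i; rewrite mulmxDl mul1mx -mulmxA /evec.
    rewrite row_delta_col mxE eqxx andbT.
    have [<-|li] := eqVneq l i; first by rewrite mulmx1 addrC subrK.
    rewrite raddf0 mulmx0 addr0; apply: gk.
    by have := ltn_ord i; move: li; rewrite -val_eqE /=; lia.
  rewrite gE; apply: elem_col; move: gS; rewrite -det_tr det_trig; last first.
    apply/is_trig_mxP => i j ij.
    have := congr1 (fun v : 'cV[R]_n => v j 0) (gk i _); rewrite /evec -colE !mxE.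
    rewrite eqxx andbT => ->; last by have := ltn_ord j; lia.
    by rewrite -val_eqE /= gtn_eqF.
  rewrite (bigD1 l) //= big1 => [|i il]; last first.
    have := congr1 (fun v : 'cV[R]_n => v i 0) (gk i _); rewrite /evec -colE !mxE !eqxx.
    by apply; have := ltn_ord i; move: il; rewrite -val_eqE /=; lia.
  by rewrite mulr1 mxE => gl; rewrite /x /evec -colE !mxE gl !eqxx subrr.
have kn : (k < n)%N by lia.
pose l := Ordinal kn.
have main (h : 'M[R]_n) (j : 'I_n) : \det h = 1 ->
    (forall i : 'I_n, (i < k)%N -> h *m evec R i = evec R i) ->
    (k < j)%N -> has_inv ((h *m evec R l) j 0) -> elem Linear h.
  move=> hS hk kj [t vt]; set v := h *m evec R l in vt.
  (* As [v_j t = 1], the coefficient at [j] corrects [v_l] to [y v = 1]; since [j > k], it affects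
     neither [e_l] nor the earlier basis vectors. *)
  pose y : 'rV[R]_n := delta_mx 0 l + ((1 - v l 0) * t) *: delta_mx 0 j.
  have yv : y *m v = 1%:M.
    rewrite mulmxDl -scalemxAl !row_delta_col scale_scalar_mx -raddfD /=.
    by congr _%:M; rewrite -mulrA [t * _]mulrC vt mulr1 addrC subrK.
  have ye (i : 'I_n) : (i <= k)%N -> y *m evec R i = (i == l)%:R%:M.
    move=> ik; rewrite mulmxDl -scalemxAl !row_delta_col !mxE andbT.
    have -> : (j == i) = false by apply/negbTE; rewrite -val_eqE /=; lia.
    by rewrite raddf0 scaler0 addr0 eq_sym.
  have yl : y *m evec R l = 1%:M by rewrite ye // eqxx.
  pose x := evec R l - v.
  have yx : y *m x = 0 by rewrite mulmxBr yl yv subrr.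
  have Ex : elem Linear (1%:M + x *m y) by apply: elem_suslin_tr yx yl.
  apply: (elem_cancell Ex); apply: (IH k.+1); first by lia.
    by rewrite det_mulmx hS mulr1; apply: (elem_Sgrp Ex).
  move=> i; rewrite ltnS leq_eqVlt => /orP[/eqP il|ik].
    have -> : i = l by apply: val_inj.
    rewrite -mulmxA -/v mulmxDl mul1mx -mulmxA yv mulmx1 /x.
    by rewrite addrC subrK.
  rewrite -mulmxA hk // mulmxDl mul1mx -mulmxA ye ?(ltnW ik) //.
  have -> : (i == l) = false by apply/negbTE; rewrite -val_eqE /=; lia.
  by rewrite raddf0 mulmx0 addr0.
have [g' [gg' g'g _]] := @Sgrp_inv Linear _ _ _ gS.
(* From [r (g e_l) = 1] and [r_j = 0] for [j < k], locality yields a unit entry of [g e_l] at an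
   index [j >= k]. *)
pose r : 'rV[R]_n := delta_mx 0 l *m g'.
have rg (i : 'I_n) : r *m (g *m evec R i) = (l == i)%:R%:M.
  by rewrite mulmxA -(mulmxA _ g') g'g mulmx1 row_delta_col mxE andbT.
have [j [kj uj]] : exists j : 'I_n, (k <= j)%N /\ has_inv ((g *m evec R l) j 0).
  have : has_inv ((r *m (g *m evec R l)) 0 0).
    by rewrite rg eqxx mxE; apply: has_inv1.
  rewrite [X in has_inv X]mxE => /has_inv_sum [j uj]; exists j.
  split; last exact: has_invMr uj.
  rewrite leqNgt; apply/negP => jk; apply: has_inv0.
  suff r0 : r 0 j = 0 by rewrite r0 mul0r in uj.
  have := rg j; rewrite gk // /evec row_col_delta.
  have -> : (l == j) = false by apply/negbTE; rewrite -val_eqE /=; lia.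
  by move=> /(congr1 (fun m : 'M_1 => m 0 0)); rewrite !mxE.
case: (ltngtP k j) kj => // [kj _|kj _]; first exact: main uj.
have k1n : (k.+1 < n)%N by lia.
pose l1 := Ordinal k1n.
have l1l : l1 != l by rewrite -val_eqE /=; lia.
have [u1|nu1] := pselect (has_inv ((g *m evec R l) l1 0)); first exact: main u1.
have Eh : elem Linear (1%:M + 1 *: delta_mx l1 l : 'M[R]_n) by apply: elem_delta.
apply: (elem_cancell Eh); apply: (main _ l1) => //.
- by rewrite det_mulmx gS mulr1; apply: (elem_Sgrp Eh).
- move=> i ik; rewrite -mulmxA gk // mulmxDl mul1mx -scalemxAl mul_delta_mx_0 ?scaler0 ?addr0 //.
  by rewrite -val_eqE /=; lia.
- rewrite -mulmxA mulmxDl mul1mx scale1r.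
  rewrite -(mul_delta_mx (0 : 'I_1)) -mulmxA row_delta_col mul_mx_scalar.
  have jl : j = l by apply: val_inj.
  move: (g *m evec R l) nu1 uj => w nu1 uj.
  by rewrite !mxE !eqxx mulr1 -jl; apply: has_inv_addl.
Qed.

(** Since [om (v - w) v = om v w], a transvection along [v - w] with the inverse of this scalar, up
    to sign, moves [v] to [w]; it fixes the vectors orthogonal to [v - w]. *)
Lemma transv_move (v w : 'cV[R]_n) : (4 <= n)%N -> has_inv (om v w) ->
  exists2 h : 'M[R]_n, elem Symplectic h &
    h *m v = w /\ forall z, om v z = om w z -> h *m z = z.
Proof.
move=> n4 [t vt]; exists (transv (v - w) (- t)); first exact: elem_transv.
split=> [|z vz]; rewrite transv_col !omlin.
  rewrite [om w v]om_sym.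
  have -> : - t * (0 - - om v w) = - 1 by rewrite -vt; ring.
  by rewrite scaleN1r opprB addrC subrK.
by rewrite vz subrr mulr0 scale0r addr0.
Qed.

(** Hyperbolic planes [(a, b)] are cleared one at a time: first [g e_a] is moved to [e_a], then the
    image of [e_b] to [e_b] with [e_a] fixed. Where the pairing that [transv_move] requires is not a
    unit, the move passes through an intermediate vector supplied by locality. *)
Lemma local_Sp : (4 <= n)%N -> ~~ odd n ->
  forall g : 'M[R]_n, Sgrp Symplectic g -> elem Symplectic g.
Proof.
move=> n4 n_even g.
suff h d k (g1 : 'M[R]_n) : (k.*2 + d.*2 = n)%N -> Sgrp Symplectic g1 ->
    (forall i : 'I_n, (i < k.*2)%N -> g1 *m evec R i = evec R i) ->
    elem Symplectic g1.
  move=> gS; apply: (h n./2 0%N) => //.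
  by rewrite double0 add0n even_halfK.
elim: d k g1 => [|d IH] k {}g kd gS gk.
  have -> : g = 1%:M; last exact: elem1.
  apply: col_mx_ext => i; rewrite mul1mx gk //.
  by have := ltn_ord i; lia.
have kn : (k.*2 < n)%N by lia.
have k1n : (k.*2.+1 < n)%N by lia.
pose a := Ordinal kn; pose b := Ordinal k1n.
have gom (h : 'M[R]_n) (v w : 'cV[R]_n) : Sgrp Symplectic h ->
    om (h *m v) (h *m w) = om v w.
  move=> [_ hp]; rewrite /om; congr (_ _ _).
  by rewrite trmx_mul -{2}hp !mulmxA.
have ab : paired a b by rewrite /paired /= odd_double eqxx.
have omab : om (evec R a) (evec R b) = 1.
  by rewrite om_evec mxE /= odd_double /= eqxx.
have omba : om (evec R b) (evec R a) = - 1 by rewrite om_sym omab.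
have omi (i j : 'I_n) : (i < k.*2)%N -> (k.*2 <= j)%N -> om (evec R j) (evec R i) = 0.
  move=> ik kj; rewrite om_evec psi_paired // /paired negb_or.
  apply/andP; split; apply/negP => /andP[oj /eqP /= ij]; first by lia.
  have jk : (j : nat) = k.*2 by lia.
  by rewrite jk odd_double in oj.
have invN1 : has_inv (- 1 : R) by apply: has_invN; apply: has_inv1.
have stepb (h : 'M[R]_n) : Sgrp Symplectic h ->
    (forall i : 'I_n, (i < k.*2)%N -> h *m evec R i = evec R i) ->
    h *m evec R a = evec R a -> elem Symplectic h.
  move=> hS hk ha.
  suff [x xE [xb xz]]: exists2 x : 'M[R]_n, elem Symplectic x &
      x *m (h *m evec R b) = evec R b /\
      forall i : 'I_n, (i <= k.*2)%N -> x *m evec R i = evec R i.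
    apply: (elem_cancell xE); apply: (IH k.+1).
    - by rewrite -kd; lia.
    - by apply: SgrpM => //; apply: elem_Sgrp.
    move=> i; rewrite doubleS !ltnS -mulmxA => ik.
    have [->|ib] := eqVneq i b; first by [].
    have {ib}ik : (i <= k.*2)%N by move: ib; rewrite -val_eqE /=; lia.
    have [ia|ia] := eqVneq i a; first by rewrite ia ha xz.
    by rewrite hk ?xz //; move: ia; rewrite -val_eqE /=; lia.
  set w := h *m evec R b.
  have wa : om w (evec R a) = - 1 by rewrite -ha gom // omba.
  have wi (i : 'I_n) : (i < k.*2)%N -> om w (evec R i) = 0.
    by move=> ik; rewrite -(hk i) // gom // omi //=; lia.
  have le (i : 'I_n) : (i <= k.*2)%N -> (i < k.*2)%N \/ i = a.
    rewrite leq_eqVlt => /orP[/eqP e|]; [right; exact: val_inj|by left].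
  have [u|nu] := pselect (has_inv (om w (evec R b))).
    have [x xE [xw xz]] := transv_move n4 u; exists x => //; split=> // i /le [ik|->].
      by apply: xz; rewrite wi // omi //=; lia.
    by apply: xz; rewrite wa omba.
  (* [om w (evec R b)] is not a unit and [om w (evec R a)] is [-1], so [om w y] is a unit. All of
     [w], [y], [e_b] pair to [-1] with [e_a], which therefore stays fixed. *)
  pose y := evec R b + evec R a.
  have u1 : has_inv (om w y) by rewrite omDr wa; apply: has_inv_addl.
  have u2 : has_inv (om y (evec R b)).
    by rewrite omDl om_alt omab add0r; apply: has_inv1.
  have [x1 x1E [x1w x1z]] := transv_move n4 u1.
  have [x2 x2E [x2w x2z]] := transv_move n4 u2.
  exists (x2 *m x1); first exact: elemM.
  rewrite -mulmxA x1w x2w; split=> // i /le [ik|->].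
    rewrite -mulmxA x1z ?x2z // ?wi //.
      by rewrite omDl !omi //= ?addr0 //; lia.
    by rewrite omDl !omi //= ?addr0 //; lia.
  by rewrite -mulmxA x1z ?x2z // omDl omba om_alt addr0 ?wa.
have va (h : 'M[R]_n) : Sgrp Symplectic h ->
    (forall i : 'I_n, (i < k.*2)%N -> h *m evec R i = evec R i) ->
    forall i : 'I_n, (i < k.*2)%N -> om (h *m evec R a) (evec R i) = 0.
  by move=> hS hk i ik; rewrite -(hk i) // gom // omi //=; lia.
set v := g *m evec R a.
have vi := va g gS gk; rewrite -/v in vi.
suff [x xE [xv xz]]: exists2 x : 'M[R]_n, elem Symplectic x &
    x *m v = evec R a /\
    forall i : 'I_n, (i < k.*2)%N -> x *m evec R i = evec R i.
  apply: (elem_cancell xE); apply: stepb.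
  - by apply: SgrpM => //; apply: elem_Sgrp.
  - by move=> i ik; rewrite -mulmxA gk // xz.
  - by rewrite -mulmxA.
suff [y [u1 [u2 yi]]]: exists y, has_inv (om v y) /\ has_inv (om y (evec R a)) /\
    forall i : 'I_n, (i < k.*2)%N -> om y (evec R i) = 0.
  have [x1 x1E [x1w x1z]] := transv_move n4 u1.
  have [x2 x2E [x2w x2z]] := transv_move n4 u2.
  exists (x2 *m x1); first exact: elemM.
  rewrite -mulmxA x1w x2w; split=> // i ik.
  rewrite -mulmxA x1z ?x2z // ?yi ?vi //.
  by rewrite omi.
have [u|nu] := pselect (has_inv (om v (evec R b))).
  exists (evec R b); split=> //; split; first by rewrite omba.
  by move=> i ik; rewrite omi //=; lia.
have [j uj] : exists j : 'I_n, has_inv (om v (evec R j)).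
  have : has_inv (om v (g *m evec R b)).
    by rewrite gom // omab; apply: has_inv1.
  rewrite [g *m evec R b]col_sum.
  rewrite (_ : om v _ = \sum_j (g *m evec R b) j 0 * om v (evec R j)).
    by move=> /has_inv_sum [j /has_invMr uj]; exists j.
  elim/big_ind2: _ => [|x1 x2 y1 y2 <- <-|j _]; last by rewrite omZr.
    by rewrite -(scale0r 0) omZr mul0r.
  by rewrite omDr.
have kj : (k.*2 <= j)%N.
  by rewrite leqNgt; apply/negP => jk; apply: has_inv0; rewrite -(vi j jk).
have jb : j != b by apply/eqP => jb; apply: nu; rewrite -jb.
(* [e_j] makes the pairing with [v] a unit, and [e_b] makes the pairing with [e_a] equal to [-1];
   [e_j] is orthogonal to [e_a] because [j] is not its partner [b]. *)
exists (evec R b + evec R j); split; first by rewrite omDr; apply: has_inv_addl.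
split=> [|i ik]; last by rewrite omDl !omi ?addr0 //=; lia.
rewrite omDl omba om_evec psi_paired ?addr0 //.
apply/negP; rewrite paired_sym => aj; move/negP: jb; apply; apply/eqP.
exact: paired_uniq aj ab.
Qed.

End Local.

Lemma local_elem c n (R : comNzRingType) (g : 'M[R]_n) : dim_ok c n ->
  local_ring R -> Sgrp c g -> elem c g.
Proof.
case: c => [n3|[n_even n6]] locR; first exact: local_SL.
by apply: local_Sp => //; apply: leq_trans n6.
Qed.

(** * Evaluation and dilation *)

Section Ev.
Variables (R T : comNzRingType).

Lemma commr_all (f : {rmorphism R -> T}) (x : T) : commr_rmorph f x.
Proof. by move=> a; apply: mulrC. Qed.

Definition ev (f : {rmorphism R -> T}) (x : T) : {poly R} -> T :=
  horner_morph (commr_all f x).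
HB.instance Definition _ f x := GRing.RMorphism.copy (ev f x)
  (horner_morph (commr_all f x)).

Lemma evE f x p : ev f x p = (map_poly f p).[x].
Proof. by []. Qed.
Lemma evC f x a : ev f x a%:P = f a.
Proof. exact: horner_morphC. Qed.
Lemma evX f x : ev f x 'X = x.
Proof. exact: horner_morphX. Qed.
Lemma ev_ext (f g : {rmorphism R -> T}) x p : f =1 g -> ev f x p = ev g x p.
Proof. by move=> fg; rewrite !evE (eq_map_poly fg). Qed.

End Ev.

Lemma ev_comp (R T U : comNzRingType) (f : {rmorphism R -> T})
  (g : {rmorphism T -> U}) x p : g (ev f x p) = ev (g \o f) (g x) p.
Proof. by rewrite !evE map_poly_comp horner_map. Qed.

Lemma ev_map (R T U : comNzRingType) (h : {rmorphism R -> T})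
  (f : {rmorphism T -> U}) x p : ev f x (map_poly h p) = ev (f \o h) x p.
Proof. by rewrite !evE map_poly_comp. Qed.

Lemma map_mx_ext (R T : Type) m n (f g : R -> T) (M : 'M[R]_(m, n)) :
  f =1 g -> map_mx f M = map_mx g M.
Proof. by move=> fg; apply/matrixP => i j; rewrite !mxE fg. Qed.

Definition dil (R : comNzRingType) (s : R) : {poly R} -> {poly R} :=
  ev polyC (s%:P * 'X).
HB.instance Definition _ (R : comNzRingType) (s : R) :=
  GRing.RMorphism.copy (dil s) (ev polyC (s%:P * 'X)).
Definition at0 (R : comNzRingType) : {poly R} -> R := ev idfun 0.
HB.instance Definition _ (R : comNzRingType) :=
  GRing.RMorphism.copy (@at0 R) (ev idfun 0).

Arguments at0 : clear implicits.

Section Dil.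
Variable R : comNzRingType.
Implicit Types (s t : R) (p : {poly R}).

Lemma dilC s a : dil s a%:P = a%:P. Proof. exact: evC. Qed.
Lemma dilX s : dil s 'X = s%:P * 'X. Proof. exact: evX. Qed.
Lemma at0C a : @at0 R a%:P = a. Proof. exact: evC. Qed.
Lemma at0X : @at0 R 'X = 0. Proof. exact: evX. Qed.

Lemma dilXM s p : dil s ('X * p) = s%:P * 'X * dil s p.
Proof. by rewrite rmorphM /= dilX. Qed.
Lemma at0XM p : at0 R ('X * p) = 0.
Proof. by rewrite rmorphM /= at0X mul0r. Qed.

Lemma poly_decomp p : exists q c, p = 'X * q + c%:P.
Proof.
elim/poly_ind: p => [|p c _]; first by exists 0, 0; rewrite mulr0 addr0.
by exists p, c; rewrite mulrC.
Qed.

Lemma dil_dil s t p : dil s (dil t p) = dil (t * s) p.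
Proof.
rewrite /dil ev_comp /= rmorphM /= evX evC mulrA -polyCM.
by apply: ev_ext => a; rewrite /= evC.
Qed.

Lemma at0_dil s p : at0 R (dil s p) = at0 R p.
Proof.
rewrite /at0 /dil ev_comp /= rmorphM /= evX mulr0.
by apply: ev_ext => a; rewrite /= evC.
Qed.

(** Write [p = X q]; then [s q = 0] and [p(s X) = s X q(s X)]. An error killed by a denominator thus
    disappears after one more dilation. *)
Lemma dil_kill s p : at0 R p = 0 -> s%:P * p = 0 -> dil s p = 0.
Proof.
have [q [c ->]] := poly_decomp p.
rewrite rmorphD /= at0XM add0r at0C => ->; rewrite addr0.
rewrite mulrCA => e.
have sq : s%:P * q = 0.
  apply/polyP => i; have := congr1 (fun r : {poly R} => r`_i.+1) e.
  by rewrite coefXM !coef0.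
by rewrite dilXM -mulrA mulrCA -(dilC s) -rmorphM sq rmorph0 mulr0.
Qed.

End Dil.

Lemma map_dil (R T : comNzRingType) (f : {rmorphism R -> T}) s p :
  map_poly f (dil s p) = dil (f s) (map_poly f p).
Proof.
rewrite /dil ev_map ev_comp rmorphM /= map_polyX map_polyC.
by apply: ev_ext => a; rewrite /= map_polyC.
Qed.

Lemma map_at0 (R T : comNzRingType) (f : {rmorphism R -> T}) p :
  at0 T (map_poly f p) = f (at0 R p).
Proof. by rewrite /at0 ev_map ev_comp rmorph0; apply: ev_ext. Qed.

(** * Common denominators for matrices and polynomials *)

Definition mult_closed (C : comNzRingType) (S : C -> Prop) :=
  S 1 /\ forall s t, S s -> S t -> S (s * t).

Definition frac_map (C D : comNzRingType) (S : C -> Prop)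
    (phi : {rmorphism C -> D}) :=
  (forall d, exists c s, S s /\ d * phi s = phi c) /\
  (forall c, phi c = 0 -> exists s, S s /\ s * c = 0).

Section FracMap.
Variables (C D : comNzRingType) (S : C -> Prop) (phi : {rmorphism C -> D}).
Hypotheses (multS : mult_closed S) (fracS : frac_map S phi).

Lemma mult_prod (I : finType) (P : pred I) (s : I -> C) :
  (forall i, S (s i)) -> S (\prod_(i | P i) s i).
Proof. by case: multS => S1 SM h; apply: big_ind => // x y; apply: (SM). Qed.

Lemma common_denom (I : finType) (d : I -> D) :
  exists s, S s /\ exists c : I -> C, forall i, phi s * d i = phi (c i).
Proof.
have [frac_ex _] := fracS.
have /choice [cs csP] : forall i, exists cs : C * C,
    S cs.2 /\ d i * phi cs.2 = phi cs.1.
  by move=> i; have [c [s h]] := frac_ex (d i); exists (c, s).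
exists (\prod_i (cs i).2); split.
  by apply: mult_prod => i; case: (csP i).
exists (fun i => (cs i).1 * \prod_(j | j != i) (cs j).2) => i.
rewrite (bigD1 i) //= !rmorphM -(csP i).2; ring.
Qed.

Lemma common_kill (I : finType) (c : I -> C) : (forall i, phi (c i) = 0) ->
  exists s, S s /\ forall i, s * c i = 0.
Proof.
move=> c0; have [_ kill] := fracS.
have /choice [s sP] : forall i, exists s, S s /\ s * c i = 0.
  by move=> i; apply: kill.
exists (\prod_i s i); split; first by apply: mult_prod => i; case: (sP i).
by move=> i; rewrite (bigD1 i) //= mulrAC (sP i).2 mul0r.
Qed.

Lemma lift_mx m n (M : 'M[D]_(m, n)) :
  exists s, S s /\ exists M', phi s *: M = map_mx phi M'.
Proof.
have [s [Ss [c cP]]] := common_denom (fun ij : 'I_m * 'I_n => M ij.1 ij.2).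
exists s; split=> //; exists (\matrix_(i, j) c (i, j)).
by apply/matrixP => i j; rewrite !mxE; apply: (cP (i, j)).
Qed.

Lemma kill_mx m n (M : 'M[C]_(m, n)) : map_mx phi M = 0 ->
  exists s, S s /\ s *: M = 0.
Proof.
move=> M0; have [|s [Ss sP]] := @common_kill _ (fun ij : 'I_m * 'I_n => M ij.1 ij.2).
  by move=> [i j] /=; have := congr1 (fun N : 'M_(m, n) => N i j) M0; rewrite !mxE.
exists s; split=> //; apply/matrixP => i j; rewrite !mxE.
exact: (sP (i, j)).
Qed.

Definition const_mult (q : {poly C}) := exists s, S s /\ q = s%:P.

Lemma const_mult_closed : mult_closed const_mult.
Proof.
case: multS => S1 SM; split; first by exists 1.
by move=> _ _ [s [Ss ->]] [t [St ->]]; exists (s * t); rewrite polyCM; split=> //; apply: (SM).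
Qed.

(** The denominators remain constants of [S], so the lemma can be iterated; [quillen_frac] relies on
    this for two variables. *)
Lemma frac_map_poly : frac_map const_mult (map_poly phi : {rmorphism {poly C} -> {poly D}}).
Proof.
split=> [p|q q0].
  have [s [Ss [c cP]]] := common_denom (fun i : 'I_(size p) => p`_i).
  exists (\poly_(i < size p) (if insub i is Some j then c j else 0)), s%:P.
  split; first by exists s.
  apply/polyP => i; rewrite /= map_polyC coefMC coef_map coef_poly /=.
  case: ifP => [ip|/negbT ip]; last first.
    by rewrite nth_default ?mul0r ?rmorph0 // leqNgt.
  by rewrite insubT /= -cP mulrC.
have [|s [Ss sP]] := @common_kill _ (fun i : 'I_(size q) => q`_i).
  by move=> i; rewrite -coef_map q0 coef0.
exists s%:P; split; first by exists s.
apply/polyP => i; rewrite coefCM coef0.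
have [iq|qi] := ltnP i (size q); first exact: (sP (Ordinal iq)).
by rewrite nth_default ?mulr0.
Qed.

End FracMap.

(** * The dilation lemma *)

Section Dilation.
Variables (c : Case) (n : nat).
Hypothesis hn : dim_ok c n.
Variables (C D : comNzRingType) (S : C -> Prop) (phi : {rmorphism C -> D}).
Hypotheses (multS : mult_closed S) (fracS : frac_map S phi).

Local Notation mphi := (map_mx (map_poly phi)).

(** The normalization of [x] at [X = 0] serves to make its later difference from a dilated matrix
    divisible by [X]. *)
Definition dil_lift (M : 'M[{poly D}]_n) := exists s, S s /\
  exists x : 'M[{poly C}]_n, [/\ elem c x, map_mx (at0 C) x = 1%:M &
    mphi x = map_mx (dil (phi s)) M].

Lemma dil_lift1 : dil_lift 1%:M.
Proof.
exists 1; split; first by case: multS.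
by exists 1%:M; rewrite !map_mx1; split=> //; apply: elem1.
Qed.

Lemma dil_liftM M N : dil_lift M -> dil_lift N -> dil_lift (M *m N).
Proof.
move=> [s [Ss [x [Ex x0 xM]]]] [t [St [y [Ey y0 yN]]]].
exists (s * t); split; first by case: multS => _; apply.
exists (map_mx (dil t) x *m map_mx (dil s) y).
have d (a b : C) (z : 'M[{poly C}]_n) (P : 'M[{poly D}]_n) :
    mphi z = map_mx (dil (phi a)) P ->
    mphi (map_mx (dil b) z) = map_mx (dil (phi (a * b))) P.
  move=> e; rewrite -map_mx_comp.
  transitivity (map_mx (dil (phi b)) (mphi z)).
    by rewrite -map_mx_comp; apply: map_mx_ext => p; rewrite /= map_dil.
  rewrite e -map_mx_comp; apply: map_mx_ext => p.
  by rewrite /= dil_dil rmorphM.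
have z (a : C) (w : 'M[{poly C}]_n) : map_mx (at0 C) (map_mx (dil a) w) = map_mx (at0 C) w.
  by rewrite -map_mx_comp; apply: map_mx_ext => p; rewrite /= at0_dil.
split.
- by apply: elemM; apply: elem_map.
- by rewrite map_mxM !z x0 y0 mulmx1.
- by rewrite map_mxM (d _ _ _ _ xM) (d _ _ _ _ yN) [t * s]mulrC map_mxM.
Qed.

Local Notation cst := (map_mx polyC).


Lemma map_dil_cst m k a (M : 'M[D]_(m, k)) : map_mx (dil a) (cst M) = cst M.
Proof. by apply/matrixP => i j; rewrite !mxE dilC. Qed.

Lemma map_cst m k (M : 'M[C]_(m, k)) : mphi (cst M) = cst (map_mx phi M).
Proof. by apply/matrixP => i j; rewrite !mxE /= map_polyC. Qed.

Lemma at0_cst (R : comNzRingType) m k (M : 'M[R]_(m, k)) :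
  map_mx (at0 R) (cst M) = M.
Proof. by apply/matrixP => i j; rewrite !mxE at0C. Qed.

(** The quantifier over [r] comes last because the dilation factor is chosen after [s] and must
    contain it. *)
Lemma lift_polyX (q : {poly D}) : exists s, S s /\ exists q1 : {poly C},
  forall r, map_poly phi ('X * dil r q1) = 'X * ((phi s)%:P * dil (phi r) q).
Proof.
have [frac_ex _] := frac_map_poly multS fracS.
have [q1 [_ [[s [Ss ->]] e]]] := frac_ex q.
exists s; split=> //; exists q1 => r.
rewrite rmorphM /= map_polyX map_dil -e /= map_polyC rmorphM /= dilC.
by congr (_ * _); rewrite mulrC.
Qed.

(** Dilating [X q] produces a factor [r], which absorbs the denominators of [q] and of the
    conjugated generator. The normality computation is then repeated over [C[X]], where Suslin's
    lemma is used with an [s] other than 1. *)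
Lemma dil_lift_gen (g g' : 'M[D]_n) ij (q : {poly D}) : Sgrp c g -> g *m g' = 1%:M ->
  dil_lift (cst g *m gen c ij ('X * q) *m cst g').
Proof.
move=> gS gg'; have [g'' [gg'' g''g _]] := Sgrp_inv gS.
have e := mx_inv_uniq g''g gg'; rewrite {g'' gg''}e in g''g.
have [s4 [Ss4 [q1 q1P]]] := lift_polyX q.
have [S1 SM] := multS.
rewrite /dil_lift; case: c hn gS => [n3 gS|[n_even n6] [gi gp]]; last first.
  have [s1 [Ss1 [v1 v1P]]] := lift_mx multS fracS (g *m sdir D ij).
  (* [s1] occurs twice because [transv] is quadratic in its direction. *)
  exists (s1 * s1 * s4); split; first by apply: (SM) => //; apply: (SM).
  exists (transv (cst v1) ('X * dil (s1 * s1 * s4) q1)); split.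
  - by apply: elem_transv; apply: leq_trans n6.
  - by rewrite transv_map /= at0XM transv0.
  rewrite transv_map /= q1P map_cst -v1P /= conj_transv; last first.
    by rewrite -(psi_map n polyC) map_trmx -!map_mxM gp.
  rewrite -mulmxA -map_mxM gg' map_mx1 mulmx1 transv_map /=.
  rewrite dilXM -(sdir_map polyC) -map_mxM map_dil_cst map_mxZ transvZ.
  by congr transv; rewrite !rmorphM; ring.
case: ij => i j /=; case: (eqVneq i j) => [_|ij].
  rewrite mulmx1 -map_mxM gg' map_mx1; exists 1; split=> //.
  by exists 1%:M; rewrite !map_mx1; split=> //; apply: elem1.
have [s1 [Ss1 [v1 v1P]]] := lift_mx multS fracS (g *m evec D i).
have [s2 [Ss2 [y1 y1P]]] := lift_mx multS fracS (delta_mx 0 j *m g' : 'rV_n).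
have [s3 [Ss3 [u1 u1P]]] := lift_mx multS fracS (delta_mx 0 i *m g' : 'rV_n).
(* The lifted row kills the lifted column only over [D]; over [C] a further factor [t] is needed. *)
have [|t [St yv0]] := @kill_mx _ _ _ _ multS fracS _ _ (y1 *m v1).
  rewrite map_mxM -v1P -y1P -scalemxAl -scalemxAr mulmxA -(mulmxA _ g').
  by rewrite g''g mulmx1 mul_delta_mx_0 ?scaler0 // eq_sym.
pose sg := (u1 *m v1) 0 0.
have sgP : phi sg = phi s1 * phi s3.
  have := congr1 (fun m : 'M_1 => m 0 0) (map_mxM phi u1 v1).
  rewrite [LHS]mxE -/sg => ->.
  rewrite -v1P -u1P -scalemxAl -scalemxAr mulmxA -(mulmxA _ g').
  by rewrite g''g mulmx1 mul_delta_mx !mxE !eqxx mulr1 mulrC.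
(* [s1 * s3] has the same image as [sg], the factor demanded by Suslin's lemma; [s4] clears [q], the
   second [s1] the column, [s2] the row, and [t] comes with the row [t *: y1]. *)
pose r := s1 * s3 * s4 * s1 * s2 * t.
exists r; split; first by rewrite /r; do !apply: (SM).
exists (1%:M + (sg%:P * ('X * dil r q1)) *: (cst v1 *m cst (t *: y1))); split.
- apply: (@elem_suslin _ _ n3 _ _ (cst u1)).
    by rewrite -map_mxM -scalemxAl yv0 raddf0.
  by rewrite -map_mxM [u1 *m v1]mx11_scalar map_scalar_mx.
- by rewrite map_mxD map_mx1 map_mxZ rmorphM /= at0XM mulr0 scale0r addr0.
rewrite map_mxD map_mx1 map_mxZ !map_mxM rmorphM /= q1P map_polyC !map_cst.
rewrite map_mxZ -v1P -y1P /= sgP.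
rewrite !map_dil_cst map_mxD map_mx1 !map_mxZ map_delta_mx /=.
rewrite mulmxDr mulmxDl mulmx1 -map_mxM gg' map_mx1 -[in RHS]scalemxAr -[in RHS]scalemxAl.
have -> : cst g *m delta_mx i j *m cst g' =
    cst (g *m evec D i) *m cst (delta_mx 0 j *m g' : 'rV_n).
  by rewrite -(map_delta_mx polyC) -!map_mxM !mulmxA -[in RHS](mulmxA g) mul_delta_mx.
congr (_ + _); rewrite -!(scalemxAl, scalemxAr) !scalerA dilXM.
by congr (_ *: _); rewrite /r !rmorphM /=; ring.
Qed.

(** Each parameter splits as [X q + a]. Pushing the constant factors to the right conjugates
    [gen c ij ('X * q)] by the value at 0 of the product before it, which is the shape treated in
    [dil_lift_gen]. *)
Lemma dil_lift_decomp (x : 'M[{poly D}]_n) : elem c x ->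
  exists M, dil_lift M /\ x = M *m cst (map_mx (at0 D) x).
Proof.
elim=> [|{}x ij f Ex [M [lM xM]]].
  by exists 1%:M; rewrite !map_mx1 mulmx1; split=> //; apply: dil_lift1.
have [q [a fE]] := poly_decomp f.
set g := map_mx (at0 D) x in xM.
have gS : Sgrp c g by apply: elem_Sgrp; apply: elem_map.
have [g' [gg' g'g _]] := Sgrp_inv gS.
exists (M *m (cst g *m gen c ij ('X * q) *m cst g')); split.
  by apply: dil_liftM => //; apply: dil_lift_gen.
rewrite map_mxM -/g gen_map fE rmorphD /= at0XM add0r at0C genD.
rewrite map_mxM gen_map {1}xM !mulmxA; congr (_ *m _).
by rewrite -(mulmxA _ (cst g')) -map_mxM g'g map_mx1 mulmx1.
Qed.

(** The lift [x] and [tau(s X)] agree over [D[X]], so some [t] in [S] kills their difference; as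
    this difference also vanishes at 0, dilating by [t] removes it. *)
Lemma dilation (tau : 'M[{poly C}]_n) : map_mx (at0 C) tau = 1%:M ->
  elem c (mphi tau) -> exists s, S s /\ elem c (map_mx (dil s) tau).
Proof.
move=> tau0 /dil_lift_decomp [M [[s [Ss [x [Ex x0 xM]]]]]].
have -> : map_mx (at0 D) (mphi tau) = 1%:M.
  rewrite -(map_mx1 phi) -tau0 -!map_mx_comp.
  by apply: map_mx_ext => p; rewrite /= map_at0.
rewrite map_mx1 mulmx1 => tauM.
pose delta := x - map_mx (dil s) tau.
have delta0 : mphi delta = 0.
  rewrite map_mxB xM -tauM -!map_mx_comp; apply/eqP; rewrite subr_eq0; apply/eqP.
  by apply: map_mx_ext => p; rewrite /= map_dil.
have [t' [[t [St ->]] td]] :=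
  kill_mx (const_mult_closed multS) (frac_map_poly multS fracS) delta0.
exists (s * t); split; first by case: multS => _; apply.
have -> : map_mx (dil (s * t)) tau = map_mx (dil t) x; last exact: elem_map.
apply/matrixP => i j; rewrite !mxE -dil_dil; apply/eqP.
rewrite eq_sym -subr_eq0 -rmorphB; apply/eqP; apply: dil_kill.
  have := congr1 (fun m : 'M_n => m i j) (etrans x0 (esym tau0)).
  by rewrite !mxE rmorphB /= at0_dil => ->; rewrite subrr.
by have := congr1 (fun m : 'M_n => m i j) td; rewrite !mxE.
Qed.

End Dilation.

(** * Quillen's local-global principle *)

Section LocalGlobal.
Variables (c : Case) (n : nat).
Hypothesis hn : dim_ok c n.
Variable R : comNzRingType.
Variables sigma sigma' : 'M[{poly R}]_n.
Hypothesis sigmaV : sigma *m sigma' = 1%:M.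

(* Quantifying over all [R]-algebras [T] and all points [x], [y] stands for the
   generic statement over [R[X, Y]] and makes [quillen] visibly an ideal. *)
Definition quillen (b : R) :=
  forall (T : comNzRingType) (f : {rmorphism R -> T}) (x y : T),
  elem c (map_mx (ev f (x + f b * y)) sigma *m map_mx (ev f x) sigma').

Lemma quillen0 : quillen 0.
Proof.
move=> T f x y; rewrite rmorph0 mul0r addr0 -map_mxM sigmaV map_mx1.
exact: elem1.
Qed.

Lemma quillenD a b : quillen a -> quillen b -> quillen (a + b).
Proof.
move=> qa qb T f x y; have := elemM (qb T f (x + f a * y) y) (qa T f x y).
rewrite mulmxA -(mulmxA _ (map_mx _ sigma')) -map_mxM (mulmx1C sigmaV).
by rewrite map_mx1 mulmx1 -addrA -mulrDl -rmorphD.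
Qed.

Lemma quillenM r b : quillen b -> quillen (r * b).
Proof.
move=> qb T f x y; have := qb T f x (f r * y).
by rewrite mulrCA mulrA -rmorphM.
Qed.

Lemma quillen1 : quillen 1 ->
  elem c (map_mx (ev idfun 1) sigma *m map_mx (at0 R) sigma').
Proof. by move=> /(_ R idfun 0 1); rewrite add0r mulr1. Qed.

(** The matrix [sigma(X + Y) sigma(X)^-1] is trivial at [Y = 0]. Dilation in [Y] over [R[X]] makes
    [sigma(X + s Y) sigma(X)^-1] elementary, and [X], [Y] are then specialized to [x], [y]. *)
Lemma quillen_frac (D : comNzRingType) (S : R -> Prop) (phi : {rmorphism R -> D}) :
  mult_closed S -> frac_map S phi -> elem c (map_mx (map_poly phi) sigma) ->
  exists s, S s /\ quillen s.
Proof.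
move=> multS fracS Es.
pose CC (T : comNzRingType) : {rmorphism T -> {poly {poly T}}} := polyC \o polyC.
pose tau := map_mx (ev (CC R) ('X%:P + 'X)) sigma *m
            map_mx (ev (CC R) ('X%:P)) sigma'.
have tau0 : map_mx (at0 _) tau = 1%:M.
  rewrite map_mxM -!map_mx_comp.
  have e (u : {poly {poly R}}) : at0 _ u = 'X ->
      at0 _ \o ev (CC R) u =1 ev (at0 _ \o CC R) 'X.
    by move=> ux p; rewrite /= ev_comp /= ux.
  rewrite (map_mx_ext _ (e _ _)); last by rewrite rmorphD /= at0X at0C addr0.
  rewrite (map_mx_ext _ (e _ _)); last by rewrite at0C.
  by rewrite -map_mxM sigmaV map_mx1.
have Etau : elem c (map_mx (map_poly (map_poly phi)) tau).
  have e (u : {poly {poly R}}) :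
      map_poly (map_poly phi) \o ev (CC R) u =1
      ev (CC D) (map_poly (map_poly phi) u) \o map_poly phi.
    move=> p; rewrite /= ev_map ev_comp; apply: ev_ext => a /=.
    by rewrite map_polyC /= map_polyC.
  have Es' : elem c (map_mx (map_poly phi) sigma').
    by apply: (elemV Es); rewrite -map_mxM sigmaV map_mx1.
  rewrite map_mxM -!map_mx_comp !(map_mx_ext _ (e _)) !map_mx_comp.
  by apply: elemM; apply: elem_map.
have [s' [[s [Ss ->]] Edil]] := dilation hn (const_mult_closed multS)
  (frac_map_poly multS fracS) tau0 Etau.
exists s; split=> // T f x y.
have := elem_map (ev (ev f x) y) Edil.
rewrite -map_mx_comp map_mxM -!map_mx_comp.
have e u : (ev (ev f x) y \o dil s%:P) \o ev (CC R) u =1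
    ev f (ev (ev f x) y (dil s%:P u)).
  move=> p; rewrite /= !ev_comp; apply: ev_ext => a /=.
  by rewrite evC /= !evC /= evC.
rewrite !(map_mx_ext _ (e _)) rmorphD rmorphD /= dilX dilC.
by rewrite [ev _ _ (_ * 'X)]rmorphM /= !evC !evX /= !evX !evC.
Qed.

End LocalGlobal.

(** * Primes containing a given ideal *)

Section Primes.
Variables (R : comNzRingType) (K J : R -> Prop).

Definition proper_ideal (I : R -> Prop) :=
  [/\ forall x, I x -> K x, I 0, forall x y, I x -> I y -> I (x + y),
      forall r x, K r -> I x -> I (r * x) & ~ I 1].

Hypotheses (K1 : K 1) (KD : forall x y, K x -> K y -> K (x + y))
  (KM : forall x y, K x -> K y -> K (x * y)).
Hypothesis J_proper : proper_ideal J.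

(** Working relative to [K] covers two uses: primes of the whole ring, and primes of the degree-zero
    part of a graded ring. *)
Lemma exists_prime : exists p, [/\ proper_ideal p, forall x, J x -> p x &
  forall a b, K a -> K b -> p (a * b) -> p a \/ p b].
Proof.
have [JK J0 JD JM J1] := J_proper.
(* Adjoining [J] lets the empty chain be bounded by [J] itself. *)
pose P (X : set R) := proper_ideal (fun x => X x \/ J x).
have [F FP Ftot|A [AP Amax]] := @Zorn_bigcup R P.
  split=> [x [[X FX Xx]|/JK //]||x y|r x Kr|].
  - by have [h _ _ _ _] := FP X FX; apply: h; left.
  - by right.
  - case=> [[X FX Xx]|Jx]; case=> [[Y FY Yy]|Jy].
    + have [XY|YX] := Ftot X Y FX FY.
        have [_ _ h _ _] := FP Y FY.
        have [|Yxy|Jxy] := h x y _ (or_introl Yy); [by left; apply: XY| |by right].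
        by left; exists Y.
      have [_ _ h _ _] := FP X FX.
      have [|Xxy|Jxy] := h x y (or_introl Xx); [by left; apply: YX| |by right].
      by left; exists X.
    + have [_ _ h _ _] := FP X FX.
      have [|Xxy|Jxy] := h x y (or_introl Xx); [by right| |by right].
      by left; exists X.
    + have [_ _ h _ _] := FP Y FY.
      have [|Yxy|Jxy] := h x y _ (or_introl Yy); [by right| |by right].
      by left; exists Y.
    + by right; apply: JD.
  - case=> [[X FX Xx]|Jx]; last by right; apply: JM.
    have [_ _ _ h _] := FP X FX.
    by have [Xrx|Jrx] := h r x Kr (or_introl Xx); [left; exists X|right].
  - case=> [[X FX X1]|//]; have [_ _ _ _ h] := FP X FX.
    by apply: h; left.
exists (fun x => A x \/ J x); split=> [//|x Jx|a b Ka Kb Iab]; first by right.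
have [AK A0 AD AM A1] := AP.
have [Ia|nIa] := pselect (A a \/ J a); [by left|right].
pose B : set R := fun x => exists i r, [/\ A i \/ J i, K r & x = i + r * a].
have IB x : A x \/ J x -> B x.
  move=> Ix; exists x, 0; split=> //; first exact: AK.
  by rewrite mul0r addr0.
have Ba : B a by exists 0, 1; split=> //; rewrite mul1r add0r.
have AB : (A `<` B)%classic.
  split=> [x Ax|BA]; first by apply: IB; left.
  by apply: nIa; left; apply: BA.
have [B1|nB1] := pselect (B 1).
  have [i [r [Ii Kr e]]] := B1.
  have -> : b = b * i + r * (a * b) by rewrite -[LHS]mulr1 e; ring.
  by apply: AD; apply: AM.
exfalso; apply: (Amax _ AB).
have BJ x : B x \/ J x -> B x by case=> // Jx; apply: IB; right.
split=> [x /BJ [i [r [Ii Kr ->]]]||x y /BJ [i [r [Ii Kr ->]]] /BJ [j [s [Ij Ks ->]]]||].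
- by apply: KD; [apply: AK|apply: KM].
- by right.
- left; exists (i + j), (r + s); split; [exact: AD|exact: KD|ring].
- move=> r x Kr /BJ [i [s [Ii Ks ->]]].
  by left; exists (r * i), (r * s); split; [apply: AM|apply: KM|ring].
- by move=> /BJ.
Qed.

End Primes.

Lemma localization_frac (R B : comNzRingType) (S : R -> Prop)
  (phi : {rmorphism R -> B}) : is_localization S phi -> frac_map S phi.
Proof.
by move=> [_ [h1 h2]]; split=> // d; have [a [s [Ss e]]] := h1 d; exists a, s.
Qed.

(** The two conditions make the complement of [S] an ideal; a fraction is then invertible exactly
    when its numerator lies in [S]. *)
Lemma localization_local (R B : comNzRingType) (S : multset R)
  (phi : {rmorphism R -> B}) : is_localization S phi ->
  (forall x y, S (x + y) -> S x \/ S y) -> (forall x y, S (x * y) -> S y) ->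
  local_ring B.
Proof.
move=> [phiS [phi_frac phi0]] SD SM.
have unitS b a s : S s -> b * phi s = phi a -> has_inv b -> S a.
  move=> Ss e [b' bb']; have [a' [s' [Ss' e']]] := phi_frac b'.
  have : phi (a * a' - s * s') = 0.
    rewrite rmorphB !rmorphM -e -e'.
    have -> : b * phi s * (b' * phi s') = (b * b') * (phi s * phi s') by ring.
    by rewrite bb' mul1r subrr.
  move=> /phi0 [u [Su eu]].
  have : S (u * (s * s')) by do 2?apply: mcarM.
  have -> : u * (s * s') = (u * a') * a.
    by apply/eqP; rewrite eq_sym -subr_eq0 -eu; apply/eqP; ring.
  exact: SM.
have Sunit b a s : S s -> b * phi s = phi a -> S a -> has_inv b.
  move=> Ss e Sa; have [t pt] := phiS a Sa.
  by exists (phi s * t); rewrite mulrA e.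
move=> x y xy_inv; have [a [s [Ss ea]]] := phi_frac x.
have [b [t [St eb]]] := phi_frac y.
have : S (a * t + b * s).
  apply: (unitS (x + y) _ (s * t)) => //; first exact: mcarM.
  by rewrite rmorphD !rmorphM -ea -eb; ring.
case/SD; rewrite mulrC => /SM h; [left; exact: Sunit Ss ea h|right; exact: Sunit St eb h].
Qed.

(** * Graded rings *)

Section Grading.
Variables (A : comNzRingType) (Ai : nat -> A -> Prop).
Hypotheses (hgr : graded Ai) (A01 : Ai 0%N 1).

(** Evaluation at 1 identifies these polynomials with [A]: [homog_ex] and [homog_inj] are the
    existence and uniqueness of homogeneous decompositions. *)
Definition homog (P : {poly A}) := forall i, Ai i P`_i.

Lemma gradedD i x y : Ai i x -> Ai i y -> Ai i (x + y).
Proof.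
have [A0 [AB _]] := hgr => Ax Ay.
by rewrite -[y]opprK -[- y]sub0r; apply: (AB) => //; apply: (AB).
Qed.

Lemma graded_sum i (I : finType) (F : I -> A) :
  (forall j, Ai i (F j)) -> Ai i (\sum_j F j).
Proof.
have [A0 _] := hgr => AF; apply: big_ind => //; exact: gradedD.
Qed.

Lemma homogB P Q : homog P -> homog Q -> homog (P - Q).
Proof. by have [_ [AB _]] := hgr => hP hQ i; rewrite coefB; apply: AB. Qed.

Lemma homogM P Q : homog P -> homog Q -> homog (P * Q).
Proof.
have [_ [_ [AM _]]] := hgr => hP hQ i; rewrite coefM.
apply: graded_sum => j; rewrite -{1}(subnKC (ltn_ord j : (j <= i)%N)).
exact: AM.
Qed.

Lemma homogC a : Ai 0%N a -> homog a%:P.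
Proof.
have [A0 _] := hgr => Aa i; rewrite coefC.
by case: eqP => [->|_].
Qed.

Lemma homog_inj P Q : homog P -> homog Q -> P.[1] = Q.[1] -> P = Q.
Proof.
move=> hP hQ e; have hD := homogB hP hQ.
have D1 : (P - Q).[1] = 0 by rewrite hornerD hornerN e subrr.
have [_ [_ [_ [_ inj]]]] := hgr.
apply/eqP; rewrite -subr_eq0; apply/eqP/polyP => i; rewrite coef0.
have [iD|Di] := ltnP i (size (P - Q)); last by rewrite nth_default.
apply: (inj (size (P - Q)) (fun i => (P - Q)`_i)) => //.
rewrite -[RHS]D1 horner_coef; apply: eq_bigr => j _.
by rewrite expr1n mulr1.
Qed.

Lemma homog_ex a : exists P, homog P /\ P.[1] = a.
Proof.
have [A0 [_ [_ [dec _]]]] := hgr; have [N [f [Af ->]]] := dec a.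
exists (\poly_(i < N) f i); split=> [i|].
  by rewrite coef_poly; case: ifP.
by rewrite horner_poly; apply: eq_bigr => i _; rewrite expr1n mulr1.
Qed.

(* [theta a = sum_i a_i T^i]; applied to the entries of [alpha] it is
   [alpha^+(T)]. *)
Lemma theta_ex : exists theta : {rmorphism A -> {poly A}},
  (forall a, homog (theta a)) /\ forall a, (theta a).[1] = a.
Proof.
have /choice [t tP] := homog_ex.
have th a : homog (t a) by case: (tP a).
have t1 a : (t a).[1] = a by case: (tP a).
(* Both sides of each morphism identity are [homog], so it suffices to compare them at 1. *)
have tB : zmod_morphism t.
  move=> a b; apply: homog_inj => //; first exact: homogB.
  by rewrite hornerD hornerN !t1.
have tM : monoid_morphism t.
  split=> [|a b]; apply: homog_inj => //.
  - exact: homogC.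
  - by rewrite t1 hornerC.
  - exact: homogM.
  - by rewrite hornerM !t1.
pose tz := GRing.isZmodMorphism.Build A {poly A} t tB.
pose tm := GRing.isMonoidMorphism.Build A {poly A} t tM.
pose T : {rmorphism A -> {poly A}} := HB.pack t tz tm.
by exists T.
Qed.

End Grading.

(** * Commutators are elementary over a ring with a suitable homotopy *)

Section Homotopy.
Variables (c : Case) (n : nat) (B : comNzRingType) (theta : {rmorphism B -> {poly B}}).
Hypotheses (hn : dim_ok c n) (theta_at1 : forall x, ev idfun 1 (theta x) = x).
Hypothesis theta_at0 : forall M : 'M[B]_n, Sgrp c M ->
  elem c (map_mx (at0 B) (map_mx theta M)).

Lemma mulmx_inv2 (R : pzRingType) (x x' y y' : 'M[R]_n) :
  x *m x' = 1%:M -> y *m y' = 1%:M -> (x *m y) *m (y' *m x') = 1%:M.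
Proof. by move=> xx' yy'; rewrite mulmxA -(mulmxA x) yy' mulmx1. Qed.

Lemma mulmx_comm_inv (R : pzRingType) (x x' y y' : 'M[R]_n) :
  x *m x' = 1%:M -> x' *m x = 1%:M -> y *m y' = 1%:M -> y' *m y = 1%:M ->
  (x *m (y *m x' *m y')) *m (y *m x *m y' *m x') = 1%:M.
Proof.
move=> xx' x'x yy' y'y; rewrite !mulmxA -(mulmxA _ y' y) y'y mulmx1.
by rewrite -(mulmxA _ x' x) x'x mulmx1 -(mulmxA _ y y') yy' mulmx1 xx'.
Qed.

(** With [d = g e^-1] this is the identity [[b, d] * d [b, e] d^-1 = [b, d e]]. *)
Lemma mulmx_comm_twist (R : pzRingType) (b b' g g' e e' : 'M[R]_n) :
  b' *m b = 1%:M -> g' *m g = 1%:M -> e *m e' = 1%:M -> e' *m e = 1%:M ->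
  (b *m ((g *m e') *m b' *m (e *m g'))) *m
    ((g *m e') *m (b *m e *m b' *m e') *m (e *m g')) = b *m g *m b' *m g'.
Proof.
move=> b'b g'g ee' e'e.
rewrite !mulmxA -(mulmxA _ g' g) g'g mulmx1 -(mulmxA _ e e') ee' mulmx1.
rewrite -(mulmxA _ b' b) b'b mulmx1 -2!(mulmxA _ e' e) e'e !mulmx1.
by [].
Qed.


Local Notation cst := (map_mx polyC).
Local Notation at1 := (map_mx (ev idfun 1)).

(* [sigma T = [beta, theta gamma * (theta gamma)(0)^-1]] is trivial at [T = 0]
   and, by normality of [elem], elementary over every local ring of [B];
   at [T = 1] it is [beta, gamma] up to elementary factors. *)
Lemma comm_elem (beta beta' gamma gamma' : 'M[B]_n) :
  Sgrp c beta -> Sgrp c gamma ->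
  beta *m beta' = 1%:M -> gamma *m gamma' = 1%:M ->
  elem c (beta *m gamma *m beta' *m gamma').
Proof.
move=> bS gS bb' gg'; have b'b := mulmx1C bb'; have g'g := mulmx1C gg'.
pose e := map_mx (at0 B) (map_mx theta gamma).
pose e' := map_mx (at0 B) (map_mx theta gamma').
have Ee : elem c e by apply: theta_at0.
have ee' : e *m e' = 1%:M by rewrite -!map_mxM gg' !map_mx1.
have e'e := mulmx1C ee'; have Ee' := elemV Ee ee'.
have cV (x x' : 'M[B]_n) : x *m x' = 1%:M -> cst x *m cst x' = 1%:M.
  by move=> xx'; rewrite -map_mxM xx' map_mx1.
have at1t (x : 'M[B]_n) : at1 (map_mx theta x) = x.
  by apply/matrixP => i j; rewrite !mxE theta_at1.
have at1c (x : 'M[B]_n) : at1 (cst x) = x.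
  by apply/matrixP => i j; rewrite !mxE evC.
pose d := map_mx theta gamma *m cst e'; pose d' := cst e *m map_mx theta gamma'.
have dS : Sgrp c d.
  by apply: SgrpM; apply: Sgrp_map => //; apply: elem_Sgrp.
have dd' : d *m d' = 1%:M.
  by apply: mulmx_inv2; [rewrite -map_mxM gg' map_mx1|apply: cV].
have d0 : map_mx (at0 B) d = 1%:M by rewrite map_mxM at0_cst.
have d'0 : map_mx (at0 B) d' = 1%:M by rewrite map_mxM at0_cst.
have d1 : at1 d = gamma *m e' by rewrite map_mxM at1c at1t.
have d'1 : at1 d' = e *m gamma' by rewrite map_mxM at1c at1t.
move: d d' dS dd' d0 d'0 d1 d'1 => d d' dS dd' d0 d'0 d1 d'1.
have d'd := mulmx1C dd'.
pose sigma := cst beta *m (d *m cst beta' *m d').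
pose sigma' := d *m cst beta *m d' *m cst beta'.
have sV : sigma *m sigma' = 1%:M by apply: mulmx_comm_inv => //; apply: cV.
have s'0 : map_mx (at0 B) sigma' = 1%:M.
  by rewrite !map_mxM !at0_cst d0 d'0 mulmx1 mul1mx.
suff q1 : quillen c sigma sigma' 1.
  have := quillen1 q1; rewrite s'0 mulmx1 !map_mxM !at1c d1 d'1 => h.
  have Eb : elem c (beta *m e *m beta') by apply: elem_conj.
  have dl : (gamma *m e') *m (e *m gamma') = 1%:M by apply: mulmx_inv2.
  have dlS : Sgrp c (gamma *m e') by apply: SgrpM => //; apply: elem_Sgrp.
  have := elemM h (elem_conj hn dlS dl (elemM Eb Ee')).
  by rewrite mulmx_comm_twist.
(* Otherwise the Quillen ideal lies in a prime [q] of [B]; but over [B_q] both [beta] and [beta']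
   are elementary, hence so is [sigma], and [quillen_frac] gives an element of the ideal outside
   [q]. *)
apply: contrapT => nq1.
have [||||q [[_ q0 qD qM q1] Jq qP]] := @exists_prime B (fun=> True)
  (quillen c sigma sigma') => //.
  split=> // [|x y|r x _].
  - exact: quillen0.
  - exact: quillenD.
  - exact: quillenM.
have S0 : ~ ~ q 0 by apply.
have SM s t : ~ q s -> ~ q t -> ~ q (s * t) by move=> ns nt /qP [].
pose S := @Multset B (fun s => ~ q s) q1 SM S0.
have psi_loc := inloc_is_localization S.
set psi := @inloc B S : {rmorphism _ -> _} in psi_loc.
have locS : local_ring (loc S).
  apply: (localization_local psi_loc) => [x y /= nxy|x y /= nxy qy].
    have [qx|] := pselect (q x); last by left.
    by right=> qy; apply: nxy; apply: qD.
  by apply: nxy; apply: qM.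
have multS : mult_closed S by split.
have [|s [Ss Js]] := quillen_frac hn sV multS (localization_frac psi_loc).
  have Ec (x : 'M[B]_n) : Sgrp c x -> elem c (map_mx (map_poly psi) (cst x)).
    by move=> xS; rewrite map_cst; apply: elem_map; apply: local_elem => //; apply: Sgrp_map.
  rewrite map_mxM; apply: elemM; first exact: Ec.
  rewrite !map_mxM; apply: (elem_conj hn).
  - exact: Sgrp_map.
  - by rewrite -map_mxM dd' map_mx1.
  - by apply: Ec; apply: SgrpV bb'.
by apply: Ss; apply: Jq.
Qed.

Lemma comm_sub_elem (x : 'M[B]_n) :
  comm_sub (Sgrp c (R := B) (n := n)) x -> elem c x.
Proof.
elim=> [|y z _ Ey [b [d [b' [d' [bS [dS [bb' [_ [dd' [_ ->]]]]]]]]]]].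
  exact: elem1.
by apply: elemM => //; apply: comm_elem.
Qed.

End Homotopy.

(** * Localization at primes of the degree-zero part *)

Section MainProof.
Variables (c : Case) (n : nat) (A : comNzRingType) (Ai : nat -> A -> Prop).
Hypotheses (hn : dim_ok c n) (hgr : graded Ai) (A01 : Ai 0%N 1).
Variable theta : {rmorphism A -> {poly A}}.
Hypotheses (theta_homog : forall a, homog Ai (theta a))
  (theta1 : forall a, (theta a).[1] = a).

Lemma thetaC a : Ai 0%N a -> theta a = a%:P.
Proof.
by move=> Aa; apply: (homog_inj hgr) => //; [exact: homogC|rewrite theta1 hornerC].
Qed.

Definition deg0 (a : A) : A := at0 A (theta a).
HB.instance Definition _ := GRing.RMorphism.copy deg0 (@at0 A \o theta).

Lemma deg0E a : deg0 a = (theta a)`_0.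
Proof.
by rewrite /deg0 /at0 evE -horner_coef0 map_poly_id.
Qed.

Lemma deg0_A0 a : Ai 0%N (deg0 a).
Proof. by rewrite deg0E; apply: theta_homog. Qed.

Lemma deg0_id a : Ai 0%N a -> deg0 a = a.
Proof. by move=> /thetaC; rewrite /deg0 => ->; rewrite at0C. Qed.

Section AtPrime.
Variable p : A -> Prop.
Hypothesis hp : prime_of_A0 Ai p.

Definition compl_prime (s : A) := Ai 0%N s /\ ~ p s.
(* The complement of the prime [p + A_+] of [A]. *)
Definition compl_prime_deg0 (s : A) := ~ p (deg0 s).

Lemma compl_prime1 : compl_prime 1.
Proof. by have [_ [_ [_ [_ [p1 _]]]]] := hp. Qed.
Lemma compl_primeM s t : compl_prime s -> compl_prime t -> compl_prime (s * t).
Proof.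
have [_ [_ [_ [_ [_ pP]]]]] := hp; have [_ [_ [AM _]]] := hgr.
move=> [As ps] [At pt]; split; first exact: (AM 0%N 0%N).
by move=> /(pP _ _ As At) [].
Qed.
Lemma compl_prime0 : ~ compl_prime 0.
Proof. by have [_ [p0 _]] := hp; case. Qed.
Definition compl_prime_mset := Multset compl_prime1 compl_primeM compl_prime0.

Lemma compl_prime_deg0_1 : compl_prime_deg0 1.
Proof.
by have [_ [_ [_ [_ [p1 _]]]]] := hp; rewrite /compl_prime_deg0 deg0_id.
Qed.
Lemma compl_prime_deg0M s t :
  compl_prime_deg0 s -> compl_prime_deg0 t -> compl_prime_deg0 (s * t).
Proof.
have [_ [_ [_ [_ [_ pP]]]]] := hp.
move=> ps pt; rewrite /compl_prime_deg0 rmorphM.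
by move=> /(pP _ _ (deg0_A0 s) (deg0_A0 t)) [].
Qed.
Lemma compl_prime_deg0_0 : ~ compl_prime_deg0 0.
Proof. by have [_ [p0 _]] := hp; rewrite /compl_prime_deg0 rmorph0. Qed.
Definition compl_prime_deg0_mset :=
  Multset compl_prime_deg0_1 compl_prime_deg0M compl_prime_deg0_0.

Let B : comNzRingType := loc compl_prime_mset.
Let phi : {rmorphism A -> B} := @inloc A compl_prime_mset.
Let phi_loc : is_localization compl_prime phi :=
  @inloc_is_localization A compl_prime_mset.
Let L : comNzRingType := loc compl_prime_deg0_mset.
Let phiL : {rmorphism A -> L} := @inloc A compl_prime_deg0_mset.
Let phiL_loc : is_localization compl_prime_deg0 phiL :=
  @inloc_is_localization A compl_prime_deg0_mset.

Lemma deg0_local : local_ring L.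
Proof.
have [_ [p0 [pD [pM [p1 pP]]]]] := hp.
apply: (@localization_local _ _ compl_prime_deg0_mset phiL) => // x y.
  rewrite /= /compl_prime_deg0 rmorphD /= => h.
  have [px|] := pselect (p (deg0 x)); last by left.
  by right=> py; apply: h; apply: pD.
rewrite /= /compl_prime_deg0 rmorphM /= => h py; apply: h; apply: pM => //.
exact: deg0_A0.
Qed.

(** [theta] extends because the denominators have degree 0. Evaluation at 0 factors as [B -> L -> B]
    through the local ring [L] of [A] at [p + A_+]; a matrix is elementary already over [L], so
    [(A_0)_p] itself need not be constructed. *)
Lemma theta_loc_ex : exists thetaB : {rmorphism B -> {poly B}},
  [/\ forall a, thetaB (phi a) = map_poly phi (theta a),
      forall x, ev idfun 1 (thetaB x) = x &
      forall M : 'M[B]_n, Sgrp c M -> elem c (map_mx (at0 B) (map_mx thetaB M))].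
Proof.
have [phiS _] := phi_loc; have [phiLS _] := phiL_loc.
pose f : {rmorphism A -> {poly B}} := map_poly phi \o theta.
have fS s : compl_prime s -> has_inv (f s).
  move=> [As ps]; have [t e] := phiS s (conj As ps).
  by exists t%:P; rewrite /f /= thetaC // map_polyC /= -polyCM e.
have [thetaB thetaBE] := localization_lift phi_loc fS.
have SL s : compl_prime s -> compl_prime_deg0 s.
  by move=> [As ps]; rewrite /compl_prime_deg0 deg0_id.
have [j jE] : exists j : {rmorphism B -> L}, forall a, j (phi a) = phiL a.
  by apply: (localization_lift phi_loc) => s /SL; apply: phiLS.
have [k kE] : exists k : {rmorphism L -> B}, forall a, k (phiL a) = phi (deg0 a).
  apply: (localization_lift phiL_loc (f := phi \o deg0)) => s ps /=.
  by apply: phiS; split=> //; apply: deg0_A0.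
exists thetaB; split=> // [x|M MS].
  pose g : {rmorphism B -> B} := ev idfun 1 \o thetaB.
  apply: (@localization_ext _ _ _ _ phi phi phi_loc phiS g idfun) => //.
  move=> a; rewrite /g /= thetaBE /f /= ev_map.
  rewrite -[in RHS](theta1 a) evE /= -[1 in LHS](rmorph1 phi) horner_map //.
have -> : map_mx (at0 B) (map_mx thetaB M) = map_mx k (map_mx j M).
  rewrite -!map_mx_comp; apply: map_mx_ext => x.
  apply: (@localization_ext _ _ _ _ phi (phi \o deg0) phi_loc _
    (@at0 B \o thetaB) (k \o j)) => [s Ss|a|a] /=.
  - by rewrite deg0_id; [exact: phiS|case: Ss].
  - by rewrite thetaBE /f /= map_at0.
  - by rewrite jE kE.
by apply: elem_map; apply: (local_elem hn deg0_local); apply: Sgrp_map.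
Qed.

(** [thetaB] preserves elementary matrices and carries [alpha_p] to the image of [alpha^+(T)]. *)
Lemma theta_elem (alpha : 'M[A]_n) :
  comm_sub (Sgrp c (R := B) (n := n)) (map_mx phi alpha) ->
  elem c (map_mx (map_poly phi) (map_mx theta alpha)).
Proof.
have [thetaB [tBE tB1 tB0]] := theta_loc_ex.
move=> /(comm_sub_elem hn tB1 tB0) /(elem_map thetaB); congr (elem c _).
by rewrite -!map_mx_comp; apply: map_mx_ext => a; rewrite /= tBE.
Qed.

End AtPrime.

Lemma graded_local_global (alpha : 'M[A]_n) :
  Sgrp c alpha -> map_mx deg0 alpha = 1%:M ->
  (forall p : A -> Prop, prime_of_A0 Ai p ->
    forall (B : comPzRingType) (phi : {rmorphism A -> B}),
    is_localization (fun s => Ai 0%N s /\ ~ p s) phi ->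
    comm_sub (Sgrp c (R := B) (n := n)) (map_mx phi alpha)) ->
  comm_sub (Sgrp c (R := A) (n := n)) alpha.
Proof.
move=> aS a0 hloc; apply: (elem_comm hn).
have [alpha' [aa' a'a a'S]] := Sgrp_inv aS.
pose sigma := map_mx theta alpha; pose sigma' := map_mx theta alpha'.
have sV : sigma *m sigma' = 1%:M by rewrite -map_mxM aa' map_mx1.
have s0 : map_mx (at0 A) sigma = 1%:M.
  by rewrite -a0 -map_mx_comp; apply: map_mx_ext.
have s'0 : map_mx (at0 A) sigma' = 1%:M.
  by rewrite -[LHS]mul1mx -{1}s0 -map_mxM sV map_mx1.
have s1 : map_mx (ev idfun 1) sigma = alpha.
  apply/matrixP => i j; rewrite !mxE evE /= -[RHS]theta1.
  by rewrite map_poly_id.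
suff q1 : quillen c sigma sigma' 1.
  by have := quillen1 q1; rewrite s1 s'0 mulmx1.
apply: contrapT => nq1.
have [A0 [AB [AM _]]] := hgr.
(* The Quillen ideal is cut down to [A_0], so that the prime and the denominators live in degree 0
   as in the hypothesis. *)
have [||||p [[pK p0 pD pM p1] Jp pP]] := @exists_prime A (Ai 0%N)
  (fun a => Ai 0%N a /\ quillen c sigma sigma' a) => //.
- by move=> x y; apply: gradedD.
- by move=> x y; apply: (AM 0%N 0%N).
- split=> [x []//||x y [Ax qx] [Ay qy]|r x Ar [Ax qx]|[_ //]].
  + by split=> //; apply: quillen0.
  + by split; [apply: gradedD|apply: quillenD].
  + by split; [apply: (AM 0%N 0%N)|apply: quillenM].
have hp : prime_of_A0 Ai p by do 5?split=> //.
pose S := compl_prime_mset hp.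
have phi_loc : is_localization (compl_prime p) (@inloc A S : {rmorphism A -> loc S}) :=
  inloc_is_localization S.
have multS : mult_closed (compl_prime p) by split; [apply: mcar1 S|apply: mcarM S].
have [|s [[As ps] qs]] := quillen_frac hn sV multS (localization_frac phi_loc).
  exact: (@theta_elem p hp alpha (hloc p hp _ _ phi_loc)).
by apply: ps; apply: Jp.
Qed.

End MainProof.

(** An equality of structures, not an isomorphism, lets all data over [A] be transported by
    substitution. *)
Lemma comNzRing_of_neq0 (A : comPzRingType) : (1 : A) != 0 ->
  exists A' : comNzRingType, A = A' :> comPzRingType.
Proof.
case: A => A cA A1.
pose P : comPzRingType := GRing.ComPzRing.Pack cA.
pose nz := GRing.PzSemiRing_isNonZero.Build P A1.
pose A' : comNzRingType := HB.pack A (GRing.ComPzRing.class P) nz.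
exists A'. case: cA @P A1 @nz @A' => *. reflexivity.
Qed.

Lemma graded_local_global_nz (c : Case) (n : nat) (A : comNzRingType)
  (Ai : nat -> A -> Prop) (alpha : 'M[A]_n) :
  graded Ai -> dim_ok c n -> Sgrp c alpha ->
  (exists (N : nat) (alphas : nat -> 'M[A]_n),
          [/\ forall i k l, Ai i (alphas i k l),
              alpha = \sum_(i < N.+1) alphas i &
              alphas 0%N = 1%:M]) ->
  (forall p : A -> Prop, prime_of_A0 Ai p ->
          forall (B : comPzRingType) (phi : {rmorphism A -> B}),
            is_localization (fun s => Ai 0%N s /\ ~ p s) phi ->
            comm_sub (Sgrp c (R:=B) (n:=n)) (map_mx phi alpha)) ->
  comm_sub (Sgrp c (R:=A) (n:=n)) alpha.
Proof.
move=> hgr hn aS [N [alphas [alphasA alphaE alphas0]]] hloc.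
have n0 : (0 < n)%N by case: c hn {aS hloc} => /= [|[_]]; apply: leq_trans.
(* The degree of 1 is read off a diagonal entry of the identity matrix [alphas 0]. *)
have A01 : Ai 0%N 1.
  have := alphasA 0%N (Ordinal n0) (Ordinal n0).
  by rewrite alphas0 mxE eqxx.
have [theta [theta_homog theta1]] := theta_ex hgr A01.
apply: (@graded_local_global c n A Ai hn hgr A01 theta theta_homog theta1) => //.
apply/matrixP => k l; rewrite mxE deg0E.
pose P := \poly_(i < N.+1) alphas i k l.
have -> : theta (alpha k l) = P.
  apply: (homog_inj hgr) => // [i|].
    by rewrite coef_poly; case: ifP => // _; have [A0 _] := hgr.
  rewrite theta1 horner_poly alphaE summxE; apply: eq_bigr => i _.
  by rewrite expr1n mulr1.
by rewrite coef_poly alphas0.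
Qed.

Theorem theorem4p8 (c : Case) (n : nat) (A : comPzRingType)
  (Ai : nat -> A -> Prop) (hgr : graded Ai) (hnoeth : noetherian A)
  (hn : dim_ok c n) (alpha : 'M[A]_n) (halpha : Sgrp c alpha)
  (h0 : exists (N : nat) (alphas : nat -> 'M[A]_n),
          [/\ forall i k l, Ai i (alphas i k l),
              alpha = \sum_(i < N.+1) alphas i &
              alphas 0%N = 1%:M])
  (hloc : forall p : A -> Prop, prime_of_A0 Ai p ->
          forall (B : comPzRingType) (phi : {rmorphism A -> B}),
            is_localization (fun s => Ai 0%N s /\ ~ p s) phi ->
            comm_sub (Sgrp c (R:=B) (n:=n)) (map_mx phi alpha)) :
  comm_sub (Sgrp c (R:=A) (n:=n)) alpha.
Proof.
have [A1|A1] := eqVneq (1 : A) 0.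
  suff -> : alpha = 1%:M by apply: comm_sub1.
  by apply/matrixP => i j; rewrite -[LHS]mul1r -[RHS]mul1r A1 !mul0r.
have [A' e] := comNzRing_of_neq0 A1.
clear A1 hnoeth; subst A.
exact: (graded_local_global_nz hgr hn halpha h0 hloc).
Qed.
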